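(* There exists a function $C(r,d)$, defined for integers $r>0$ and $d\ge 3$ and depending only on $r$ and $d$, with the following property. Let $r>0$ and $d\geq 3$ be integers, let $k$ be any field with $d!\neq 0$ in $k$ (that is, $k$ has characteristic zero or characteristic $>d$), let $V$ be any finite-dimensional $k$-vector space, and let $P:V\to k$ be any polynomial of degree $d$ such that $r(\Delta_t P)\leq r$ for all $t\in V$. Then $r(P)\leq C(r,d)$.
   Context: For a polynomial $P$ on $V$ and $t\in V$, $\Delta_tP$ is the polynomial $\Delta_tP(x):=P(x+t)-P(x)$. Rank. Let $k$ be a field with algebraic closure $\bar k$ and let $V$ be a finite-dimensional $k$-vector space. For a homogeneous polynomial $P$ on $V$ of degree $e\geq 2$, the rank $r(P)$ is the minimal number $r$ such that $P$ can be written as $P=\sum_{i=1}^r L_iR_i$, where $L_i,R_i$ are homogeneous polynomials on $V$ with coefficients in $\bar k$, of positive degrees. For an arbitrary polynomial $P$ of degree $e\geq 2$ one sets $r(P):=r(P_e)$, where $P_e$ is the homogeneous part of $P$ of degree $e$. Polynomials of degree $\le 1$ (including the zero polynomial) are assigned rank $0$, so the hypothesis $r(\Delta_tP)\le r$ imposes no condition for those $t$ for which $\Delta_tP$ has degree $\le 1$. *)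

(* Defs.v *)
From mathcomp Require Import all_boot all_algebra.
From mathcomp Require Import boolp.
From mathcomp Require Import mpoly.

Set Implicit Arguments.
Unset Strict Implicit.
Unset Printing Implicit Defensive.

Import GRing.Theory.
Local Open Scope ring_scope.

(* Polynomials on V are formal polynomials in the coordinates of the
   library's basis [vbasis fullv]: the variable 'X_i is the linear form
   [coord (vbasis fullv) i]. *)
Definition polyOn (k : fieldType) (V : vectType k) : Type :=
  {mpoly k[\dim {:V}]}.

Definition vcoord (k : fieldType) (V : vectType k) (x : V)
    (i : 'I_(\dim {:V})) : k :=
  coord (vbasis {:V}) i x.

Definition evalOn (k : fieldType) (V : vectType k) (P : polyOn V) (x : V) : k :=
  meval (vcoord x) P.

Definition Delta (k : fieldType) (V : vectType k) (t : V) (P : polyOn V) :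
    polyOn V :=
  (P \mPo [tuple 'X_i + (vcoord t i)%:MP | i < \dim {:V}]) - P.

Lemma evalOn_Delta (k : fieldType) (V : vectType k) (t : V) (P : polyOn V)
    (x : V) :
  evalOn (Delta t P) x = evalOn P (x + t) - evalOn P x.
Proof.
rewrite /evalOn /Delta mevalB comp_mpoly_meval; congr (_ - _).
apply: meval_eq => i; rewrite tnth_map tnth_ord_tuple mevalD mevalXU mevalC.
by rewrite /vcoord linearD.
Qed.

(* The zero polynomial gets degree 0. *)
Definition mdegree (n : nat) (R : nzRingType) (P : {mpoly R[n]}) : nat :=
  (msize P).-1.

Definition top_part (n : nat) (R : nzRingType) (P : {mpoly R[n]}) :
    {mpoly R[n]} :=
  pihomog mdeg (mdegree P) P.

Definition homog_pos (n : nat) (R : nzRingType) (P : {mpoly R[n]}) : Prop :=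
  exists2 e : nat, (0 < e)%N & P \is e.-homog.

Section Rank.
Variables (n : nat) (k K : fieldType) (iota : {rmorphism k -> K}).
Implicit Type P : {mpoly k[n]}.

Definition decomposes P (r : nat) : Prop :=
  exists L R : 'I_r -> {mpoly K[n]},
    (forall i, homog_pos (L i) /\ homog_pos (R i)) /\
    map_mpoly iota P = \sum_(i < r) L i * R i.

Lemma decomposes_ex P (e : nat) :
  (1 < e)%N -> P \is e.-homog -> exists r, decomposes P r.
Proof.
move=> e1 hP.
have step (m : 'X_{1..n}) (c : K) : mdeg m = e ->
    exists L R : {mpoly K[n]},
      [/\ homog_pos L, homog_pos R & c *: 'X_[m] = L * R].
  move=> me; have [i mi] : exists i, (0 < m i)%N.
    apply/existsP; rewrite -[X in is_true X]negbK negb_exists.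
    apply/negP => /forallP h; have: mdeg m = 0%N.
      by rewrite mdegE big1 // => i _; apply/eqP; rewrite -leqn0 leqNgt.
    by rewrite me => e0; rewrite e0 in e1.
  have Um : (U_(i) <= m)%MM.
    apply/mnm_lepP => j; rewrite mnm1E; case: eqP => [<-|] //.
  have dU : mdeg (m - U_(i))%MM = e.-1.
    have := mdegD (m - U_(i))%MM U_(i)%MM.
    by rewrite submK // me mdeg1 addn1 => ->.
  exists (c *: 'X_i), 'X_[m - U_(i)]; split.
  - by exists 1%N => //; apply: rpredZ; rewrite dhomogX /= mdeg1.
  - by exists e.-1; [case: (e) e1 => [|[]] | rewrite dhomogX /= dU].
  - by rewrite -scalerAl -mpolyXD addmC submK.
have [s hs eP] : exists2 s : seq (K * 'X_{1..n}),
    (forall x, x \in s -> mdeg x.2 = e)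
    & map_mpoly iota P = \sum_(x <- s) x.1 *: 'X_[x.2].
  exists [seq (iota P@_m, m) | m <- msupp P].
    by move=> x /mapP[m mP ->] /=; exact: (dhomog_mf hP mP).
  rewrite big_map {1}(mpolyE P) raddf_sum; apply: eq_bigr => m _ /=.
  by rewrite -mul_mpolyC rmorphM /= map_mpolyC map_mpolyX mul_mpolyC.
rewrite /decomposes eP {eP}; elim: s hs => [|x s IH] hs.
  exists 0%N, (fun=> 0), (fun=> 0); split; first by case.
  by rewrite big_nil big_ord0.
have [|r [L [R [LR eLR]]]] := IH.
  by move=> y ys; apply: hs; rewrite inE ys orbT.
have [|L0 [R0 [hL hR e0]]] := step x.2 x.1; first by apply: hs; rewrite mem_head.
exists r.+1, (fun i => oapp L L0 (unlift ord0 i)),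
  (fun i => oapp R R0 (unlift ord0 i)); split.
  by move=> i; case: unliftP => [j|] _ //=.
rewrite big_cons big_ord_recl unlift_none /= e0 eLR; congr (_ + _).
by apply: eq_bigr => i _; rewrite liftK.
Qed.

Lemma rank_ex P :
  (1 < mdegree P)%N -> exists r, asbool (decomposes (top_part P) r).
Proof.
move=> h; have [r hr] := decomposes_ex h (pihomogP mdeg (mdegree P) P).
by exists r; apply/asboolP.
Qed.

Definition rank P : nat :=
  match pselect (1 < mdegree P)%N with
  | left h => ex_minn (rank_ex h)
  | right _ => 0
  end.

Lemma rank_spec P : (1 < mdegree P)%N ->
  decomposes (top_part P) (rank P) /\
  forall r, decomposes (top_part P) r -> (rank P <= r)%N.
Proof.
move=> h; rewrite /rank; case: pselect => // h'; case: ex_minnP => r /asboolP hr hm.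
by split=> // s hs; apply: hm; apply/asboolP.
Qed.

Lemma rank_small P : (mdegree P <= 1)%N -> rank P = 0%N.
Proof.
move=> h; rewrite /rank; case: pselect => // h1.
by have := leq_trans h1 h; rewrite ltnn.
Qed.

End Rank.

(* Main.v *)
Require Import Defs.
From mathcomp Require Import all_boot all_algebra.
From mathcomp Require Import mpoly.
From HB Require Import structures.
From mathcomp Require Import boolp perm zify ring.
Set Implicit Arguments.
Unset Strict Implicit.
Unset Printing Implicit Defensive.
Import GRing.Theory.
Local Open Scope ring_scope.

(** Let f be the leading form of P over the algebraically closed field K, and
    let D + 2 be its degree. The leading form of a difference of P is the
    derivative of f in the corresponding direction, when this derivative is
    nonzero ([Delta_top]). Let S be the image of {0, ..., D + 2} in K. As
    (D + 2)! is nonzero these D + 3 elements are distinct, and the hypothesis bounds the rank of the derivative of f in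
    every direction with coordinates in S. The objects to study are the polar
    forms

      G_j(t, x) = sum_i t_i (d_i d_j f)(x),

    linear in t and of degree D in x, which are the partial derivatives in x
    of the derivative of f in the direction t. If the latter is a sum of r
    products of forms of positive degree, then by the Leibniz rule all the
    G_j(t, -) lie in the ideal of the 2r factors.

    First, there is an N depending on r and D only such that for every t in
    K^n the G_j(t, -) have a common nonzero zero in every subspace of dimension
    N + 1 ([meets_small_subspaces]). In a fixed degree, the dimension of the
    ideal of the G_j(t, -) restricted to such a subspace is the rank of a matrix
    that is linear in t. For t in S^n it is small, because an ideal with 2r
    generators is small; and a bound for the rank on the grid S^n gives a
    slightly weaker bound for all t ([rank_grid]), since a determinant cannot
    vanish to high order at all points of a grid. Without a common zero,
    however, combinations of the G_j(t, -) would form a regular sequence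
    ([regular_combinations]), whose ideal is too large
    ([regular_sequence_dim]).

    Secondly, the zeros of G(t, -) form a cone that meets all subspaces of
    dimension N + 1. A linear projection as in Noether normalization shows that
    it carries as many points in general position for forms of a given degree
    as a space of dimension n - N ([dual_points]).

    Thirdly, consider the relations sum_j c_j G_j = 0 with c_j bihomogeneous of
    some bidegree comparable to n. Counting unknowns, equations and points
    (t, x) with G(t, x) = 0, one finds such a point where the values of these
    relations span K^n up to s directions, where s is independent of n
    ([syzygies_at_point]).

    Finally, expand everything along lines through that point, replacing (t, x)
    by (t0 + e X, x0 + e X) with X the vector of variables. Since G vanishes at
    the point and the relations have almost the identity as constant terms, they
    determine the coefficients of all the G_j, recursively, from those of s of
    their combinations ([propagation]). The coefficient of e^(D + 1) in G_j is
    sum_i X_i d_i d_j f, and Euler's identity recovers (D + 2)(D + 1) f from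
    these. This writes f as a sum of s (D + 1) products ([rank_of_syzygies]). *)

(** * Orders of vanishing on a grid *)

Section GridOrder.
Variable K : closedFieldType.

Lemma dvdp_prod_XsubC_exp (S : seq K) (J : nat) (r : {poly K}) :
  uniq S -> (forall a, a \in S -> ('X - a%:P) ^+ J %| r) ->
  \prod_(a <- S) ('X - a%:P) ^+ J %| r.
Proof.
elim: S => [|a S IH] /=; first by rewrite big_nil dvd1p.
move=> /andP[aS uS] h; rewrite big_cons Gauss_dvdp.
  rewrite h ?mem_head //=; apply: IH => // b bS.
  by apply: h; rewrite inE bS orbT.
apply: coprimep_expl; rewrite coprimep_sym.
elim: {IH h uS} S aS => [|b S IH]; first by rewrite big_nil coprime1p.
rewrite inE negb_or => /andP[ab aS].
rewrite big_cons coprimepMl IH // andbT.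
by apply: coprimep_expl; rewrite coprimep_XsubC root_XsubC.
Qed.

(** A polynomial of degree at most l vanishes to order at most l / #|S| at some
    point of S: otherwise the product of the corresponding powers of the X - a
    would divide it. *)
Lemma shifted_coef_neq0 (S : seq K) (l : nat) (r : {poly K}) :
  uniq S -> (0 < size S)%N -> r != 0 -> (size r <= l.+1)%N ->
  exists a j, [/\ a \in S, (size S * j <= l)%N &
     (r \Po ('X + a%:P))`_j != 0].
Proof.
move=> uS S0 r0 sr; pose J := (l %/ size S).+1.
have [/allP h|/allPn[a aS ha]] := boolP (all (fun a => ('X - a%:P) ^+ J %| r) S).
  have := dvdp_leq r0 (dvdp_prod_XsubC_exp uS h).
  have -> : \prod_(a <- S) ('X - a%:P) ^+ J = (\prod_(a <- S) ('X - a%:P)) ^+ J.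
    by rewrite prodrXl.
  move=> hs; have := leq_trans hs sr.
  rewrite polySpred ?expf_neq0 ?monic_neq0 ?monic_prod_XsubC // size_exp.
  rewrite size_prod_XsubC ltnS mulnC => h2.
  by have := ltn_ceil l S0; rewrite ltnNge h2.
have [/forallP h|] := boolP [forall j : 'I_J, (r \Po ('X + a%:P))`_j == 0].
  case/negP: ha.
  have : r \Po ('X + a%:P) = drop_poly J (r \Po ('X + a%:P)) * 'X^J.
    rewrite -{1}(poly_take_drop J (r \Po _)) [take_poly _ _](_ : _ = 0) ?add0r //.
    apply/polyP => i; rewrite coef_take_poly coef0; case: ltnP => // iJ.
    by apply/eqP; have := h (Ordinal iJ).
  move/(congr1 (fun p => p \Po ('X - a%:P))).
  rewrite comp_polyM comp_Xn_poly -comp_polyA.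
  by rewrite comp_polyD comp_polyX comp_polyC subrK comp_polyXr => ->; apply: dvdp_mull.
rewrite negb_forall => /existsP[j hj]; exists a, j; split=> //.
have := ltn_ord j; rewrite ltnS => hjl.
by rewrite mulnC -leq_divRL.
Qed.

Notation line a w := (mmap (@polyC K) (fun i => (a i)%:P + w i *: 'X)).

Lemma msize_coef_muni n (p : {mpoly K[n.+1]}) i :
  (muni p)`_i != 0 -> (msize (muni p)`_i + i <= msize p)%N.
Proof.
move=> c0; rewrite -(mlead_deg c0); have := mlead_supp c0.
move: (mlead _) => m'; rewrite muniE coef_sum mcoeff_msupp raddf_sum /=.
apply: contraNT; rewrite -ltnNge => lt.
rewrite big_seq big1 // => m mp; rewrite coefZ coefXn.
case: eqP => [e|_]; last by rewrite mulr0 mcoeff0.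
rewrite mulr1 mcoeffZ mcoeffX; case: eqP => [e'|_]; last by rewrite mulr0.
have := msize_mdeg_lt mp; rewrite ltnNge.
suff -> : mdeg m = (mdeg m' + i)%N by rewrite -ltnS lt.
by rewrite mdegE big_ord_recr /= -e -e' mdegE; under [in RHS]eq_bigr do rewrite mnmE.
Qed.

Definition extend n (T : Type) (a' : 'I_n -> T) (a : T) (i : 'I_n.+1) : T :=
  oapp a' a (unlift ord_max i).

Lemma extend_widen n (T : Type) (a' : 'I_n -> T) a (i : 'I_n) :
  extend a' a (widen_ord (leqnSn n) i) = a' i.
Proof.
rewrite /extend; have -> : widen_ord (leqnSn n) i = lift ord_max i.
  by apply: val_inj; rewrite /= /bump leqNgt ltn_ord.
by rewrite liftK.
Qed.

Lemma extend_max n (T : Type) (a' : 'I_n -> T) a : extend a' a ord_max = a.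
Proof. by rewrite /extend unlift_none. Qed.

(** Restricting to a line commutes with singling out the last variable. This is
    what lets the bound on orders of vanishing be proved by induction on the
    number of variables. *)
Lemma line_muni n (a' w' : 'I_n -> K) a w (p : {mpoly K[n.+1]}) :
  line (extend a' a) (extend w' w) p =
  (map_poly (line a' w') (muni p)).[a%:P + w *: 'X].
Proof.
have lineD q : line (extend a' a) (extend w' w) q =
    \sum_(m <- msupp q) q@_m *: line (extend a' a) (extend w' w) 'X_[m].
  rewrite {1}(mpolyE q) raddf_sum /=; apply: eq_bigr => m _.
  by rewrite mmapZ mul_polyC.
rewrite lineD muniE raddf_sum horner_sum /=; apply: eq_bigr => m _.
rewrite map_polyZ /= map_polyXn hornerZ hornerXn.
rewrite mmapZ !mmapX /mmap1 big_ord_recr /= !extend_max mul_polyC.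
rewrite -scalerAl; congr (_ *: (_ * _)).
by apply: eq_bigr => i _; rewrite !extend_widen mnmE.
Qed.

Lemma muni_neq0 n (p : {mpoly K[n.+1]}) : p != 0 -> muni p != 0.
Proof.
rewrite -msupp_eq0; case E: (msupp p) => [//|m s] _.
have mp : m \in msupp p by rewrite E mem_head.
pose m' := [multinom m (widen_ord (leqnSn n) i) | i < n].
suff h : ((muni p)`_(m ord_max))@_m' = p@_m.
  apply/eqP => h0; move: mp; rewrite mcoeff_msupp -h h0 coef0 mcoeff0.
  by rewrite eqxx.
rewrite muniE coef_sum raddf_sum /= (bigD1_seq m) ?msupp_uniq //= big1.
  by rewrite coefZ coefXn eqxx mulr1 mcoeffZ mcoeffX eqxx mulr1 addr0.
move=> m1 m1m; rewrite coefZ coefXn; case: eqP => [e|_]; last first.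
  by rewrite mulr0 mcoeff0.
rewrite mulr1 mcoeffZ mcoeffX; case: eqP => [/mnmP e'|_]; last by rewrite mulr0.
case/eqP: m1m; apply/mnmP => i; case: (unliftP ord_max i) => [k|] -> //.
have -> : lift ord_max k = widen_ord (leqnSn n) k.
  by apply: val_inj; rewrite /= /bump leqNgt ltn_ord.
by have := e' k; rewrite !mnmE.
Qed.

Lemma coef_shift_coef (Q : {poly {poly K}}) (a : K) i m :
  ((Q \Po ('X + a%:P%:P))`_i)`_m =
  ((\poly_(j < size Q) (Q`_j)`_m) \Po ('X + a%:P))`_i.
Proof.
rewrite comp_polyE poly_def !coef_sum [(\sum_(_ < _) _) \Po _]raddf_sum coef_sum /=.
apply: eq_bigr => k _; rewrite coefZ comp_polyZ comp_Xn_poly coefZ.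
have -> : ('X + a%:P%:P : {poly {poly K}}) = map_poly (@polyC K) ('X + a%:P).
  by rewrite rmorphD /= map_polyX map_polyC.
by rewrite -rmorphXn coef_map /= coefMC.
Qed.

(** The Schwartz-Zippel bound with multiplicities, in the form of an existence
    statement: some point of the grid and some line through it where p vanishes
    to order at most deg p / #|S|. The induction restricts the leading
    coefficient in the last variable to a line first, and chooses the slope in the
    last variable at the end, such that the coefficient of order m' + j survives. *)
Lemma schwartz_zippel_order n (S : seq K) (p : {mpoly K[n]}) :
  uniq S -> (0 < size S)%N -> p != 0 ->
  exists a w : 'I_n -> K, exists m,
   [/\ forall i, a i \in S, (size S * m <= (msize p).-1)%N & (line a w p)`_m != 0].
Proof.
move=> uS S0; elim: n p => [|n IH] p p0.
  exists (fun=> 0), (fun=> 0), 0%N; split; first by case.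
    by rewrite muln0.
  rewrite (nvar0_mpolyC p) mmapC coefC eqxx.
  by apply: contra p0; rewrite {2}(nvar0_mpolyC p) => /eqP ->; rewrite mpolyC0.
pose P := muni p; have P0 : P != 0 by apply: muni_neq0.
pose l := (size P).-1; have c0 : P`_l != 0 by rewrite -lead_coefE lead_coef_eq0.
have hl := msize_coef_muni c0.
have [a' [w' [m' [aS hm' hc]]]] := IH _ c0.
pose Q := map_poly (line a' w') P.
have sQ : (size Q <= l.+1)%N by rewrite -polySpred //; apply: size_poly.
(* The part of order m' in the first variables, as a polynomial in the last one. *)
pose r := \poly_(j < size Q) (Q`_j)`_m'.
have r0 : r != 0.
  apply/eqP => /polyP/(_ l); rewrite coef_poly coef0 coef_map /=.
  case: ltnP => [_ /eqP|le _]; first by rewrite (negPf hc).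
  move: hc; rewrite -[mmap _ _ _](coef_map (line a' w')) -/Q [Q`_l]nth_default // coef0.
  by rewrite eqxx.
have sr : (size r <= l.+1)%N by apply: leq_trans (size_poly _ _) sQ.
have [a [j [aS' hj hr]]] := shifted_coef_neq0 uS S0 r0 sr.
pose Q' := Q \Po ('X + a%:P%:P).
have hQ' i : (Q'`_i)`_m' = (r \Po ('X + a%:P))`_i.
  exact: coef_shift_coef.
(* The coefficient of order m' + j on the line, as a function of the slope. *)
pose u := \poly_(i < (m' + j).+1) (Q'`_i)`_(m' + j - i).
have u0 : u != 0.
  apply/eqP => /polyP/(_ j); rewrite coef_poly ltnS leq_addl addnK coef0 hQ'.
  by move/eqP; rewrite (negPf hr).
have [w hw] := closed_nonrootP u u0.
exists (extend a' a), (extend w' w), (m' + j)%N; split.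
- by move=> i; rewrite /extend; case: unlift.
- rewrite mulnDr; apply: (leq_trans (leq_add hm' hj)).
  have c1 : (0 < msize P`_l)%N by rewrite lt0n msize_poly_eq0.
  move: c1 hl; rewrite -/P; move: (msize _) (msize _) => x y; clear; lia.
rewrite line_muni -/P -/Q.
have -> : Q.[a%:P + w *: 'X] = Q'.[w *: 'X].
  by rewrite horner_comp hornerD hornerX hornerC addrC.
have hw' : u.[w] = (Q'.[w *: 'X])`_(m' + j).
  rewrite (horner_coef_wide _ (size_poly _ _)) horner_coef coef_sum.
  under [RHS]eq_bigr => i _ do rewrite exprZn -scalerAr coefZ coefMXn.
  pose F i := w ^+ i * (if (m' + j < i)%N then 0 else (Q'`_i)`_(m' + j - i)).
  transitivity (\sum_(i < (m' + j).+1) F i).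
    apply: eq_bigr => i _; rewrite coef_poly ltn_ord /F mulrC.
    by rewrite ltnNge -ltnS ltn_ord.
  rewrite -!(big_mkord xpredT F).
  have h1 : \sum_(0 <= i < (m' + j).+1 + size Q') F i
          = \sum_(0 <= i < (m' + j).+1) F i.
    rewrite (big_cat_nat (leq0n _) (leq_addr _ _)) /= [X in _ + X](_ : _ = 0) ?addr0 //.
    rewrite big_nat big1 // => i /andP[h _].
    by rewrite /F h mulr0.
  have h2 : \sum_(0 <= i < (m' + j).+1 + size Q') F i
          = \sum_(0 <= i < size Q') F i.
    rewrite (big_cat_nat (leq0n (size Q')) (leq_addl _ _)) /=.
    rewrite [X in _ + X](_ : _ = 0) ?addr0 // big_nat big1 // => i /andP[h _].
    rewrite /F [Q'`_i]nth_default // coef0.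
    by rewrite if_same mulr0.
  by rewrite -h1 h2.
by rewrite -hw' -[_ != 0]/(~~ root u w).
Qed.
End GridOrder.

Section RankGrid.
Variable K : closedFieldType.
Notation line a w := (mmap (@polyC K) (fun i => (a i)%:P + w i *: 'X)).

Lemma dhomog_big_prod n (R : comNzRingType) (I : Type) (s : seq I) (P : pred I)
    (F : I -> {mpoly R[n]}) (d : I -> nat) :
  (forall i, P i -> F i \is (d i).-homog) ->
  \prod_(i <- s | P i) F i \is (\sum_(i <- s | P i) d i)%N.-homog.
Proof.
move=> h; elim/big_rec2: _ => [|i e p Pi hp]; first exact: dhomog1.
exact: dhomogM (h i Pi) hp.
Qed.

Lemma msize_homog n (R : nzRingType) (p : {mpoly R[n]}) d :
  p \is d.-homog -> (msize p <= d.+1)%N.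
Proof.
move/dhomogP => h; rewrite msizeE; apply/bigmax_leqP_seq => m mp _.
by rewrite h.
Qed.

Lemma det_linear_homog n r (A : 'I_n -> 'M[K]_r) :
  \det (\sum_i 'X_i *: map_mx (@mpolyC n K) (A i)) \is r.-homog.
Proof.
apply: rpred_sum => s _; rewrite mulr_sign.
have h : \prod_i (\sum_i0 'X_i0 *: map_mx (mpolyC n (R:=K)) (A i0)) i (s i)
    \is r.-homog.
  rewrite -[r in r.-homog]card_ord -sum1_card; apply: dhomog_big_prod => i _.
  rewrite summxE; apply: rpred_sum => j _; rewrite !mxE mulrC mul_mpolyC.
  by apply: rpredZ; rewrite dhomogX /= mdeg1.
by case: ifP => _; rewrite ?dhomogN.
Qed.

(** After row and column operations A is a diagonal of ones and zeros, and each
    zero row contributes a factor X to the determinant. *)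
Lemma det_pencil_order r (A B : 'M[K]_r) m :
  (\det (map_mx polyC A + 'X *: map_mx polyC B))`_m != 0 ->
  (r <= \rank A + m)%N.
Proof.
apply: contraNT; rewrite -ltnNge => lt.
set L := col_ebase A; set U := row_ebase A; set k := \rank A in lt *.
have eA : A = L *m pid_mx k *m U by rewrite mulmx_ebase.
have uL : L \in unitmx by apply: col_ebase_unit.
have uU : U \in unitmx by apply: row_ebase_unit.
pose B' := invmx L *m B *m invmx U.
have eB : B = L *m B' *m U.
  by rewrite /B' !mulmxA mulmxV // mul1mx mulmxKV.
pose D : 'M[{poly K}]_r := diag_mx (\row_i (if (i < k)%N then 1 else 'X)).
pose E : 'M[{poly K}]_r := \matrix_(i, j)
  (if (i < k)%N then (pid_mx k i j)%:P + 'X * (B' i j)%:P else (B' i j)%:P).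
have -> : map_mx polyC A + 'X *: map_mx polyC B =
    map_mx polyC L *m (D *m E) *m map_mx polyC U.
  have -> : D *m E = map_mx polyC (pid_mx k) + 'X *: map_mx polyC B'.
    apply/matrixP => i j; rewrite mul_diag_mx !mxE; case: ltnP => ik.
      by rewrite mul1r.
    by rewrite andbF polyC0 add0r.
  by rewrite mulmxDr mulmxDl -scalemxAr -scalemxAl -!map_mxM -eA -eB.
rewrite !det_mulmx det_diag.
rewrite (eq_bigr (fun i : 'I_r => if (i < k)%N then 1 else 'X)); last first.
  by move=> i _; rewrite mxE.
have -> : \prod_(i < r) (if (i < k)%N then 1 else 'X) = 'X^(r - k) :> {poly K}.
  rewrite -(big_mkord xpredT (fun i => if (i < k)%N then 1 else 'X : {poly K})).
  have kr : (k <= r)%N by apply: rank_leq_row.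
  rewrite (big_cat_nat (leq0n k) kr) /= [X in X * _](_ : _ = 1) ?mul1r.
    rewrite big_nat (eq_bigr (fun=> 'X)) -?big_nat ?prodr_const_nat // => i.
    by case/andP => ki _; rewrite ltnNge ki.
  by rewrite big_nat big1 // => i /andP[_ ->].
rewrite [X in X * _]mulrCA -mulrA mulrC coefMXn ifT ?eqxx //.
by rewrite ltn_subRL.
Qed.

(** Let R be the rank at t. A minor of size R that is invertible at t is a
    nonzero form of degree R in t, so it vanishes to order at most R / #|S| at some
    point of the grid, while it vanishes there to order at least R - rho. *)
Lemma rank_grid n p q (M : 'I_n -> 'M[K]_(p, q)) (S : seq K) (rho : nat) :
  uniq S -> (0 < size S)%N ->
  (forall a : 'I_n -> K, (forall i, a i \in S) ->
     (\rank (\sum_i a i *: M i)%R <= rho)%N) ->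
  forall t : 'I_n -> K,
  (size S * \rank (\sum_i t i *: M i)%R <=
   size S * rho + \rank (\sum_i t i *: M i)%R)%N.
Proof.
move=> uS S0 hS t; pose Mt (t : 'I_n -> K) := \sum_i t i *: M i.
rewrite -/(Mt t); set r := \rank (Mt t).
(* Instead of selecting a minor, compress by matrices that diagonalize at t. *)
pose U : 'M[K]_(r, p) := pid_mx r *m invmx (col_ebase (Mt t)).
pose V : 'M[K]_(q, r) := invmx (row_ebase (Mt t)) *m pid_mx r.
have UV : U *m Mt t *m V = 1%:M.
  have -> : U *m Mt t *m V =
      U *m (col_ebase (Mt t) *m pid_mx r *m row_ebase (Mt t)) *m V.
    by rewrite mulmx_ebase.
  rewrite /U /V !mulmxA (mulmxKV (col_ebase_unit _)).
  rewrite (mulmxK (row_ebase_unit _)) -pid_mx_1.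
  by rewrite !pid_mx_id //; [exact: rank_leq_col | exact: rank_leq_row].
pose A i := U *m M i *m V.
have At u : U *m Mt u *m V = \sum_i u i *: A i.
  rewrite /Mt mulmx_sumr mulmx_suml; apply: eq_bigr => i _.
  by rewrite -scalemxAr -scalemxAl.
pose P : {mpoly K[n]} := \det (\sum_i 'X_i *: map_mx (@mpolyC n K) (A i)).
have P0 : P != 0.
  apply/eqP => h0; have : meval t P = 1.
    rewrite /P -det_map_mx -(det1 K r) -UV At; congr (\det _).
    rewrite raddf_sum; apply: eq_bigr => i _; apply/matrixP => j k.
    by rewrite !mxE /= mevalM mevalXU mevalC.
  by rewrite h0 meval0 => /eqP; rewrite eq_sym oner_eq0.
have [a [w [m [aS hm hc]]]] := schwartz_zippel_order uS S0 P0.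
have sP : ((msize P).-1 <= r)%N.
  by have := msize_homog (det_linear_homog A); rewrite -/P; case: (msize P).
have hd : (r <= \rank (U *m Mt a *m V) + m)%N.
  rewrite At; apply: (det_pencil_order (B := \sum_i w i *: A i)).
  have <- // : (mmap (@polyC K) (fun i => (a i)%:P + w i *: 'X)) P =
    \det (map_mx polyC (\sum_i a i *: A i) +
          'X *: map_mx polyC (\sum_i w i *: A i)).
  rewrite /P -det_map_mx; congr (\det _); apply/matrixP => j k.
  rewrite !mxE !summxE !rmorph_sum mulr_sumr -big_split; apply: eq_bigr => i _.
  rewrite !mxE rmorphM /= mmapX mmapC mmap1U !rmorphM /= mulrDl.
  by rewrite -mul_polyC; congr (_ + _); rewrite mulrCA mulrA.
have hr : (\rank (U *m Mt a *m V) <= rho)%N.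
  apply: leq_trans (hS a aS); apply: leq_trans (mxrankM_maxl _ _) _.
  exact: mxrankM_maxr.
apply: leq_trans (leq_mul (leqnn _) hd) _; rewrite mulnDr.
by apply: leq_add; [rewrite leq_mul2l hr orbT | apply: leq_trans sP].
Qed.
End RankGrid.

(** * Families that are regular in every order *)

Section Ideals.
Variables (K : fieldType) (n : nat).
Notation A := {mpoly K[n]}.

Lemma pihomogMr (d e : nat) (q t : A) : t \is e.-homog ->
  pihomog mdeg d (q * t) =
  if (e <= d)%N then pihomog mdeg (d - e) q * t else 0.
Proof.
move=> ht; rewrite {1}(pihomog_partitionE (leqnn (mmeasure mdeg q))).
rewrite mulr_suml raddf_sum /=.
have h k : pihomog mdeg d (pihomog mdeg k q * t) =
    if d == (k + e)%N then pihomog mdeg k q * t else 0.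
  have hk : pihomog mdeg k q * t \is (k + e).-homog.
    by apply: dhomogM ht; apply: pihomogP.
  case: eqP => [->|/eqP ne]; first by rewrite pihomog_dE.
  by rewrite (pihomog_ne0 _ hk) // eq_sym.
under eq_bigr do rewrite h.
case: leqP => [led|ltd]; last first.
  rewrite big1 // => k _; case: eqP => // e1.
  by move: ltd; rewrite e1 ltnNge leq_addl.
have e1 k : (d == (k + e)%N) = (k == (d - e)%N).
  by rewrite -{1}(subnK led) eqn_add2r eq_sym.
have [lt|ge] := ltnP (d - e) (msize q).
  rewrite (bigD1 (Ordinal lt)) //= e1 eqxx big1 ?addr0 // => k.
  by rewrite e1 -val_eqE /= => /negPf ->.
rewrite big1 => [|k _]; last first.
  by rewrite e1; case: eqP => // ek; move: (ltn_ord k); rewrite ek ltnNge ge.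
suff -> : pihomog mdeg (d - e) q = 0 by rewrite mul0r.
rewrite pihomogE big_seq_cond big_pred0 // => m; apply/negP => /andP[mq /eqP em].
by have := msize_mdeg_lt mq; rewrite em ltnNge ge.
Qed.

Lemma pihomogMl (d e : nat) (q t : A) : t \is e.-homog ->
  pihomog mdeg d (t * q) =
  if (e <= d)%N then t * pihomog mdeg (d - e) q else 0.
Proof. by move=> ht; rewrite mulrC (pihomogMr _ _ ht) [X in if _ then X else _]mulrC. Qed.

Definition ideal (I : finType) (th : I -> A) (S : {set I}) (p : A) : Prop :=
  exists q : I -> A, p = \sum_(j in S) q j * th j.

Section OneFamily.
Variables (I : finType) (th : I -> A).
Implicit Types (S T : {set I}) (p q : A).

Lemma ideal0 S : ideal th S 0.
Proof. by exists (fun=> 0); rewrite big1 // => j _; rewrite mul0r. Qed.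

Lemma idealD S p q : ideal th S p -> ideal th S q -> ideal th S (p + q).
Proof.
move=> [u ->] [v ->]; exists (fun j => u j + v j); rewrite -big_split /=.
by apply: eq_bigr => j _; rewrite mulrDl.
Qed.

Lemma idealMl S a p : ideal th S p -> ideal th S (a * p).
Proof.
move=> [u ->]; exists (fun j => a * u j); rewrite mulr_sumr.
by apply: eq_bigr => j _; rewrite mulrA.
Qed.

Lemma idealMr S a p : ideal th S p -> ideal th S (p * a).
Proof. by rewrite mulrC; apply: idealMl. Qed.

Lemma idealN S p : ideal th S p -> ideal th S (- p).
Proof. by rewrite -mulN1r; apply: idealMl. Qed.

Lemma idealB S p q : ideal th S p -> ideal th S q -> ideal th S (p - q).
Proof. by move=> hp hq; apply: idealD => //; apply: idealN. Qed.

Lemma ideal_sum S (J : Type) (s : seq J) (P : pred J) (F : J -> A) :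
  (forall j, P j -> ideal th S (F j)) -> ideal th S (\sum_(j <- s | P j) F j).
Proof.
by move=> h; elim/big_rec: _ => [|j p Pj hp];
  [exact: ideal0 | apply: idealD => //; apply: h].
Qed.

Lemma ideal_gen S j : j \in S -> ideal th S (th j).
Proof.
move=> jS; exists (fun i => (i == j)%:R); rewrite (bigD1 j) //= eqxx mul1r.
by rewrite big1 ?addr0 // => i /andP[_ /negPf ->]; rewrite mul0r.
Qed.

Lemma ideal_sub S T p : S \subset T -> ideal th S p -> ideal th T p.
Proof.
move=> /subsetP ST [q ->]; apply: ideal_sum => j jS.
by apply: idealMl; apply: ideal_gen; apply: ST.
Qed.

Lemma ideal_setU1 S (l : I) p : l \notin S -> ideal th (l |: S) p ->
  exists a, ideal th S (p - a * th l).
Proof.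
move=> lS [q ->]; exists (q l); rewrite (big_setU1 _ lS) /= addrAC subrr add0r.
by exists q.
Qed.

Definition homog_family := forall i, exists2 e : nat, (0 < e)%N & th i \is e.-homog.

Lemma ideal_pihomog S d p : homog_family -> ideal th S p ->
  ideal th S (pihomog mdeg d p).
Proof.
move=> hth [q ->]; rewrite raddf_sum /=; apply: ideal_sum => j jS.
have [e _ he] := hth j; rewrite (pihomogMr _ _ he); case: ifP => _.
  by apply: idealMl; apply: ideal_gen.
exact: ideal0.
Qed.

(** Each member is a non-zero-divisor modulo any set of the others. For forms
    this follows from being a regular sequence, but the symmetric version is the
    one that is preserved by exchanging a single member. *)
Definition strongly_regular := forall (S : {set I}) (l : I) (b : A),
  l \notin S -> ideal th S (th l * b) -> ideal th S b.
End OneFamily.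

Lemma ideal_eq (I : finType) (th th' : I -> A) (S : {set I}) p :
  {in S, th =1 th'} -> ideal th S p -> ideal th' S p.
Proof. by move=> h [q ->]; exists q; apply: eq_bigr => j jS; rewrite h. Qed.

(** If beta b is in the ideal of S, then b = th_l c_1 modulo S with beta c_1
    again in the ideal of S, because th_l is a non-zero-divisor. Iterating, b is
    divisible by all powers of th_l modulo S, which is impossible for degree
    reasons unless b is in the ideal. *)
Lemma regular_modulo_descent (I : finType) (th : I -> A) (S : {set I}) l (beta : A) :
  homog_family th -> strongly_regular th -> l \notin S ->
  (forall b, ideal th (l |: S) (beta * b) -> ideal th (l |: S) b) ->
  forall b, ideal th S (beta * b) -> ideal th S b.
Proof.
move=> hth sr lS hb b hbb.
have step k : exists c, ideal th S (b - th l ^+ k * c) /\ ideal th S (beta * c).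
  elim: k => [|k [c [h1 h2]]].
    by exists b; rewrite expr0 mul1r subrr; split=> //; apply: ideal0.
  have hc : ideal th (l |: S) c.
    by apply: hb; apply: ideal_sub h2; apply: subsetUr.
  have [a ha] := ideal_setU1 lS hc; exists a; split.
    have -> : b - th l ^+ k.+1 * a =
        (b - th l ^+ k * c) + th l ^+ k * (c - a * th l).
      by rewrite exprS; ring.
    by apply: idealD => //; apply: idealMl.
  apply: (sr S l) => //.
  have -> : th l * (beta * a) = beta * c - beta * (c - a * th l) by ring.
  by apply: idealB => //; apply: idealMl.
have [e e0 he] := hth l; have [c [h1 _]] := step (msize b).
rewrite (pihomog_partitionE (leqnn (mmeasure mdeg b))); apply: ideal_sum => d _.
have -> : pihomog mdeg d b = pihomog mdeg d (b - th l ^+ msize b * c).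
  rewrite raddfB /= (pihomogMl _ _ (dhomogMn (msize b) he)) ifN ?subr0 //.
  rewrite -ltnNge; apply: leq_trans (ltn_ord d) _.
  by rewrite leq_pmull.
exact: ideal_pihomog.
Qed.

Definition replace (I : eqType) (th : I -> A) (l : I) (beta : A) (i : I) : A :=
  if i == l then beta else th i.

Lemma ideal_replace (I : finType) (th : I -> A) l beta (S : {set I}) p :
  l \notin S -> ideal (replace th l beta) S p <-> ideal th S p.
Proof.
move=> lS; split; apply: ideal_eq => i iS; rewrite /replace ifN //;
  by apply: contraNneq lS => <-.
Qed.

Lemma regular_modulo_sub (I : finType) (th : I -> A) l (beta : A) :
  homog_family th -> strongly_regular th ->
  (forall b, ideal th [set~ l] (beta * b) -> ideal th [set~ l] b) ->
  forall (S : {set I}) b, l \notin S -> ideal th S (beta * b) -> ideal th S b.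
Proof.
move=> hth sr hb S; have [k] := ubnP #|~: S|.
elim: k S => // k IH S; rewrite ltnS => hk b lS.
have [e|] := eqVneq S [set~ l]; first by rewrite e; apply: hb.
move=> neS; have [j jl jS] : exists2 j, j != l & j \notin S.
  apply/exists_inP; apply: contraNT neS; rewrite negb_exists_in.
  move=> /forall_inP h; apply/eqP/setP => i; rewrite !inE.
  have [->|il] := eqVneq i l; first by rewrite (negPf lS).
  by have := h i il; rewrite negbK.
apply: (regular_modulo_descent hth sr jS) => c.
apply: IH; last by rewrite !inE negb_or eq_sym jl.
apply: leq_trans hk; apply: proper_card; apply/properP; split.
  by rewrite setCS; apply: subsetUr.
by exists j; rewrite !inE ?eqxx.
Qed.

(** The exchange step: it suffices that the new member be a non-zero-divisor
    modulo all the remaining ones together, by descent to smaller sets. *)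
Lemma strongly_regular_replace (I : finType) (th : I -> A) l (beta : A) e :
  homog_family th -> strongly_regular th -> (0 < e)%N -> beta \is e.-homog ->
  (forall b, ideal th [set~ l] (beta * b) -> ideal th [set~ l] b) ->
  strongly_regular (replace th l beta).
Proof.
move=> hth sr e0 he hb S i b iS.
have hbS := regular_modulo_sub hth sr hb.
have [ei|il] := eqVneq i l.
  move: iS; rewrite ei => lS; rewrite !ideal_replace // [replace _ _ _ _]/replace eqxx.
  exact: hbS.
have -> : replace th l beta i = th i by rewrite /replace (negPf il).
have [lS|lS] := boolP (l \in S); last first.
  by rewrite !ideal_replace //; apply: sr.
pose S0 := S :\ l; have eS : S = l |: S0 by rewrite setD1K.
have lS0 : l \notin S0 by rewrite !inE eqxx.
have iS0 : i \notin S0 by rewrite inE (negPf iS) andbF.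
rewrite eS => /(ideal_setU1 lS0)[a]; rewrite [replace _ _ _ l]/replace eqxx ideal_replace //.
move=> h; have ha : ideal th (i |: S0) (beta * a).
  have -> : beta * a = b * th i - (th i * b - a * beta) by ring.
  apply: idealB; last by apply: ideal_sub h; apply: subsetUr.
  by apply: idealMl; apply: ideal_gen; rewrite setU11.
have {}ha : ideal th (i |: S0) a.
  by apply: hbS ha; rewrite !inE negb_or eq_sym il eqxx.
have [c hc] := ideal_setU1 iS0 ha.
have hd : ideal th S0 (b - c * beta).
  apply: (sr S0 i) => //.
  have -> : th i * (b - c * beta) = (th i * b - a * beta) + beta * (a - c * th i).
    by ring.
  by apply: idealD => //; apply: idealMl.
rewrite -[b](subrK (c * beta)); apply: idealD.
  by apply: (@ideal_sub _ _ S0); [exact: subsetUr | rewrite ideal_replace].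
apply: idealMl; have e1 : replace th l beta l = beta by rewrite /replace eqxx.
by rewrite -{2}e1; apply: ideal_gen; rewrite setU11.
Qed.

End Ideals.

Section VarsRegular.
Variables (K : fieldType) (n : nat).
Notation A := {mpoly K[n]}.
Notation vars := (fun i : 'I_n => 'X_i : A).

(** An ideal generated by variables is a monomial ideal. *)
Lemma ideal_varsP (S : {set 'I_n}) (p : A) :
  ideal vars S p <-> forall m, m \in msupp p -> exists2 j, j \in S & (0 < m j)%N.
Proof.
split=> [[q ->] m|h].
  move/msupp_sum_le => /flattenP[s] /mapP[j]; rewrite mem_filter => /andP[jS _] ->.
  rewrite (perm_mem (msuppMX _ _)) => /mapP[m' _ ->]; exists j => //.
  by rewrite mnmDE mnm1E eqxx.
rewrite (mpolyE p) big_seq; apply: ideal_sum => m mp.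
have [j jS mj] := h m mp; rewrite -mul_mpolyC; apply: idealMl.
have -> : m = (m - U_(j) + U_(j))%MM.
  rewrite submK //; apply/mnm_lepP => i; rewrite mnm1E; case: eqP => [<-|] //.
by rewrite mpolyXD; apply: idealMl; apply: ideal_gen.
Qed.

Lemma vars_regular : strongly_regular vars.
Proof.
move=> S l b lS; rewrite !ideal_varsP => h m mb.
have [|j jS] := h (m + U_(l))%MM.
  by rewrite mulrC (perm_mem (msuppMX _ _)) addmC; apply: map_f.
rewrite mnmDE mnm1E; case: eqP => [lj|_]; last by rewrite addn0; exists j.
by move: lS; rewrite lj jS.
Qed.

Lemma vars_homog : homog_family vars.
Proof. by move=> i; exists 1%N => //; rewrite dhomogX /= mdeg1. Qed.
End VarsRegular.

(** * Zeros of ideals that are finite over the constants *)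

Section IdealPredicates.
Variable A : comNzRingType.

Definition is_ideal (J : A -> Prop) :=
  [/\ J 0, forall p q, J p -> J q -> J (p + q) & forall a p, J p -> J (a * p)].

Definition adjoin (J : A -> Prop) (b p : A) := exists a, J (p - a * b).

Lemma is_ideal_adjoin J b : is_ideal J -> is_ideal (adjoin J b).
Proof.
move=> [J0 JD JM]; split.
- by exists 0; rewrite mul0r subr0.
- move=> p q [a ha] [c hc]; exists (a + c).
  have -> : p + q - (a + c) * b = (p - a * b) + (q - c * b) by ring.
  exact: JD.
- move=> a p [c hc]; exists (a * c).
  have -> : a * p - a * c * b = a * (p - c * b) by ring.
  exact: JM.
Qed.

Lemma adjoin_sub J b p : J p -> adjoin J b p.
Proof. by move=> hp; exists 0; rewrite mul0r subr0. Qed.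

Lemma adjoin_gen J b : is_ideal J -> adjoin J b b.
Proof. by case=> J0 _ _; exists 1; rewrite mul1r subrr. Qed.

(** If a proper J contains a product, one of its factors can be added to J without
    reaching 1, since the factors invertible modulo J can be cancelled. *)
Lemma adjoin_prod_proper J (T : eqType) (s : seq T) (F : T -> A) :
  is_ideal J -> ~ J 1 -> J (\prod_(t <- s) F t) ->
  exists2 t, t \in s & ~ adjoin J (F t) 1.
Proof.
move=> iJ J1; have [J0 JD JM] := iJ.
have h0 b c : adjoin J b 1 -> J (b * c) -> J c.
  move=> [a ha] hbc; have -> : c = c * (1 - a * b) + a * (b * c) by ring.
  by apply: JD; apply: JM.
move=> hs; apply: contrapT => hn; case: J1.
have {}hn t : t \in s -> adjoin J (F t) 1.
  by move=> ts; apply: contrapT => ht; apply: hn; exists t.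
elim: s hs hn => [|t s IH]; first by rewrite big_nil.
rewrite big_cons => hp hn; apply: IH; first exact: h0 (hn t (mem_head _ _)) hp.
by move=> t' ts; apply: hn; rewrite inE ts orbT.
Qed.
End IdealPredicates.

Section ZeroDim.
Variables (K : closedFieldType) (n : nat).
Notation A := {mpoly K[n]}.

Notation atvar i u := (map_poly (@mpolyC n K) u).['X_i].

Lemma ideal_eval (J : A -> Prop) (xi : 'I_n -> K) p : is_ideal J ->
  (forall i, J ('X_i - (xi i)%:MP)) -> J (p - (p.@[xi])%:MP).
Proof.
move=> [J0 JD JM] h.
have JMr a q : J q -> J (q * a) by move=> hq; rewrite mulrC; exact: JM.
have hX (q r : A) : J (q - (q.@[xi])%:MP) -> J (r - (r.@[xi])%:MP) ->
    J (q * r - ((q * r).@[xi])%:MP).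
  move=> hq hr; rewrite mevalM mpolyCM.
  have -> : q * r - (q.@[xi])%:MP * (r.@[xi])%:MP =
    q * (r - (r.@[xi])%:MP) + (q - (q.@[xi])%:MP) * (r.@[xi])%:MP by ring.
  by apply: JD; [apply: JM | apply: JMr].
have hXk j k : J ('X_j ^+ k - (('X_j ^+ k).@[xi])%:MP).
  elim: k => [|k IH]; first by rewrite expr0 meval1 mpolyC1 subrr.
  by rewrite exprS; apply: (hX _ _ _ IH); rewrite mevalXU.
have hm m : J ('X_[m] - (('X_[m]).@[xi])%:MP).
  rewrite mpolyXE_id; elim/big_rec: _ => [|i q _ hq].
    by rewrite meval1 mpolyC1 subrr.
  exact: hX.
elim/mpolyind: p => [|c m p _ _ IH]; first by rewrite meval0 mpolyC0 subrr.
rewrite mevalD mevalZ mpolyCD mpolyCM -mul_mpolyC.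
have -> : c%:MP * 'X_[m] + p - (c%:MP * ('X_[m].@[xi])%:MP + (p.@[xi])%:MP) =
  c%:MP * ('X_[m] - ('X_[m].@[xi])%:MP) + (p - (p.@[xi])%:MP) by ring.
by apply: JD => //; apply: JM.
Qed.

(** Each variable satisfies an equation modulo J, which splits into linear
    factors over K. By [adjoin_prod_proper] one can add an X_i - xi_i to J for one i
    after the other, and the resulting proper ideal is the one of a point. *)
Lemma zero_dim_nullstellensatz (J : A -> Prop) (u : 'I_n -> {poly K}) :
  is_ideal J -> ~ J 1 -> (forall i, u i != 0) -> (forall i, J (atvar i (u i))) ->
  exists xi, (forall i, root (u i) (xi i)) /\ (forall p, J p -> p.@[xi] = 0).
Proof.
move=> iJ J1 u0 Ju.
have step (s : seq 'I_n) : exists J' : A -> Prop, exists xi,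
    [/\ is_ideal J', ~ J' 1, (forall p, J p -> J' p) &
     forall i, i \in s -> root (u i) (xi i) /\ J' ('X_i - (xi i)%:MP)].
  elim: s => [|i s [J' [xi [iJ' J'1 sub hs]]]].
    by exists J, (fun=> 0); split.
  have [rs ers] := closed_field_poly_normal (u i).
  have h : J' (\prod_(z <- rs) ('X_i - z%:MP)).
    have [_ _ JM] := iJ'; have := JM ((lead_coef (u i))^-1)%:MP _ (sub _ (Ju i)).
    rewrite {2}ers map_polyZ /= rmorph_prod /= hornerZ horner_prod mulrA -mpolyCM.
    rewrite mulVf ?lead_coef_eq0 // mpolyC1 mul1r.
    by under eq_bigr do rewrite rmorphB /= map_polyX map_polyC /= hornerXsubC.
  have [z zrs hz] := adjoin_prod_proper iJ' J'1 h.
  have iJz := is_ideal_adjoin ('X_i - z%:MP) iJ'.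
  have rz : root (u i) z.
    by rewrite ers rootZ ?lead_coef_eq0 // root_prod_XsubC.
  exists (adjoin J' ('X_i - z%:MP)), (fun j => if j == i then z else xi j).
  split=> // [p /sub|j]; first exact: adjoin_sub.
  rewrite inE; case: (eqVneq j i) => [-> _|_ /= js].
    by split=> //; apply: adjoin_gen.
  by have [? ?] := hs j js; split=> //; apply: adjoin_sub.
have [J' [xi [iJ' J'1 sub hs]]] := step (enum 'I_n).
exists xi; split=> [i|p /sub hp]; first by have [] := hs i (mem_enum _ _).
apply/eqP/negP => /negP pn0; case: J'1.
have [J0 JD JM] := iJ'.
have hxi i : J' ('X_i - (xi i)%:MP) by have [] := hs i (mem_enum _ _).
have hJ : J' (p.@[xi])%:MP.
  have -> : (p.@[xi])%:MP = p + (-1) * (p - (p.@[xi])%:MP) by ring.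
  by apply: JD => //; apply: JM; apply: ideal_eval.
have -> : 1 = ((p.@[xi])^-1)%:MP * (p.@[xi])%:MP :> A.
  by rewrite -mpolyCM mulVf.
exact: JM.
Qed.
End ZeroDim.

Section FiniteDim.
Variables (K : closedFieldType) (n : nat).
Notation A := {mpoly K[n]}.
Notation atvar i u := (map_poly (@mpolyC n K) u).['X_i].

(** When every polynomial is congruent modulo J to one of bounded degree, the
    powers of q are linearly dependent modulo J. *)
Lemma dependent_powers (J : A -> Prop) (B : nat) (q : A) : is_ideal J ->
  (forall p, exists2 r, (msize r <= B)%N & J (p - r)) ->
  exists2 u : {poly K}, u != 0 & J (map_poly (@mpolyC n K) u).[q].
Proof.
move=> [J0 JD JM] red; pose h := #|{: 'X_{1..n < B}}|.
have [r hr] := choice (fun k => let: ex_intro2 r h1 h2 := red (q ^+ k) in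
  ex_intro (fun r => (msize r <= B)%N /\ J (q ^+ k - r)) r (conj h1 h2)).
pose R : 'M[K]_(h.+1, h) := \matrix_(k, j) (r k)@_(enum_val j : 'X_{1..n < B}).
have /rowV0Pn[v vk v0] : kermx R != 0.
  rewrite kermx_eq0 /row_free neq_ltn.
  by rewrite ltnS rank_leq_col.
have {vk} vR := sub_kermxP vk.
exists (\poly_(k < h.+1) v 0 (inord k)).
  apply: contra v0 => /eqP/polyP hv; apply/eqP/rowP => k; rewrite mxE.
  by have := hv k; rewrite coef_poly ltn_ord inord_val coef0.
rewrite (@horner_coef_wide _ h.+1); last first.
  exact: leq_trans (size_poly _ _) (size_poly _ _).
have e : \sum_(k < h.+1) v 0 k *: r k = 0.
  apply/mpolyP => m; rewrite raddf_sum /= mcoeff0.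
  have [lt|ge] := ltnP (mdeg m) B.
    have := congr1 (fun M : 'rV_h => M 0 (enum_rank (BMultinom lt))) vR.
    rewrite !mxE => e0; rewrite -[RHS]e0; apply: eq_bigr => k _.
    by rewrite mcoeffZ mxE enum_rankK.
  rewrite big1 // => k _; rewrite mcoeffZ [_@_m]memN_msupp_eq0 ?mulr0 //.
  by apply: msize_mdeg_ge; apply: leq_trans ge; case: (hr k).
rewrite (_ : \sum_(i < _) _ =
   \sum_(k < h.+1) (v 0 k)%:MP * (q ^+ k - r k)); last first.
  rewrite -[LHS]subr0 -[X in _ - X = _]e -sumrB; apply: eq_bigr => k _.
  by rewrite coef_map coef_poly ltn_ord /= inord_val mulrBr -mul_mpolyC.
by elim/big_rec: _ => // k p _ hp; apply: JD => //; apply: JM; case: (hr k).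
Qed.

(** Modulo X_l = 1 the hypothesis allows to replace X_i^(E+1) by the form a_i of
    smaller degree, so all exponents can be brought down to at most E. *)
Lemma reduce_degree (Th : A -> Prop) (l : 'I_n) (E : nat) (a : 'I_n -> A) :
  is_ideal Th -> (forall i, a i \is E.-homog) ->
  (forall i, Th ('X_i ^+ E.+1 - 'X_l * a i)) ->
  forall p, exists2 r, (msize r <= n * E.+1)%N & adjoin Th ('X_l - 1) (p - r).
Proof.
move=> iTh ha hTh; set J := adjoin _ _; set B := (n * E.+1)%N.
have iJ : is_ideal J by apply: is_ideal_adjoin.
have [J0 JD JM] := iJ.
have redm (s : seq 'X_{1..n}) (c : 'X_{1..n} -> K) :
    (forall m, m \in s -> exists2 r, (msize r <= B)%N & J ('X_[m] - r)) ->
    exists2 r, (msize r <= B)%N & J (\sum_(m <- s) c m *: 'X_[m] - r).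
  elim: s => [|m s IH] hs.
    by exists 0; rewrite ?msize0 // big_nil subrr.
  have [r1 s1 h1] := hs m (mem_head _ _).
  have [|r2 s2 h2] := IH; first by move=> m' ms; apply: hs; rewrite inE ms orbT.
  exists (c m *: r1 + r2).
    apply: leq_trans (msizeD_le _ _) _; rewrite geq_max s2 andbT.
    exact: leq_trans (mmeasureZ_le _ _ _) s1.
  rewrite big_cons -!mul_mpolyC; move: (\sum_(_ <- _) _) h2 => T h2.
  have -> : (c m)%:MP * 'X_[m] + T - ((c m)%:MP * r1 + r2) =
    (c m)%:MP * ('X_[m] - r1) + (T - r2) by ring.
  by apply: JD => //; apply: JM.
suff red k : forall p, (msize p <= k)%N ->
    exists2 r, (msize r <= B)%N & J (p - r) by move=> p; apply: (red (msize p)).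
elim: k => [|k IH] p sp.
  exists 0; rewrite ?msize0 // subr0.
  by move: sp; rewrite leqn0 msize_poly_eq0 => /eqP ->.
rewrite (mpolyE p); apply: redm => m mp.
have [lt|ge] := ltnP (mdeg m) B.
  by exists 'X_[m]; rewrite ?msizeX // subrr.
have [i mi] : exists i, (E < m i)%N.
  apply/existsP; apply: contraLR ge; rewrite negb_exists -ltnNge => /forallP h.
  apply: (@leq_ltn_trans (n * E)%N); last by rewrite ltn_pmul2l // (leq_ltn_trans _ (ltn_ord l)).
  rewrite mdegE -[n in (n * _)%N]card_ord -sum_nat_const; apply: leq_sum => i _.
  by rewrite leqNgt h.
have em : m = (m - U_(i) *+ E.+1 + U_(i) *+ E.+1)%MM.
  rewrite submK //; apply/mnm_lepP => j; rewrite mulmnE mnm1E.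
  by case: eqP => [<-|] //; rewrite mul1n.
have [|r sr hr] := IH ('X_[(m - U_(i) *+ E.+1)] * a i).
  have hh : 'X_[(m - U_(i) *+ E.+1)] * a i \is (mdeg (m - U_(i) *+ E.+1)%MM + E).-homog.
    by apply: dhomogM => //; rewrite dhomogX.
  apply: leq_trans (msize_homog hh) _.
  have := msize_mdeg_lt mp; have := congr1 mdeg em.
  rewrite mdegD mdegMn mdeg1 mul1n; move: sp.
  move: (mdeg _) (mdeg _) (msize _) => x y z; clear; lia.
exists r => //; rewrite em mpolyXD -mpolyXn.
set q := 'X_[_]; set y := 'X_i ^+ _.
have -> : q * y - r = q * (y - 'X_l * a i) + (q * a i) * ('X_l - 1) + (q * a i - r).
  by ring.
have h1 : J (y - 'X_l * a i) := adjoin_sub _ (hTh i).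
have h2 : J ('X_l - 1) by apply: adjoin_gen.
exact: JD (JD _ _ (JM _ _ h1) (JM _ _ h2)) hr.
Qed.
End FiniteDim.

(** * Forms without common zeros contain a regular sequence *)

Section Chain.
Variables (K : closedFieldType) (n : nat).
Notation A := {mpoly K[n]}.
Notation atvar i u := (map_poly (@mpolyC n K) u).['X_i].

(** For homogeneous families: the origin is the only common zero. *)
Definition cofinite (th : 'I_n -> A) :=
  forall i, exists e, ideal th setT ('X_i ^+ e).

Lemma is_ideal_ideal (I : finType) (th : I -> A) S : is_ideal (ideal th S).
Proof.
by split; [exact: ideal0 | move=> p q; exact: idealD | move=> a p; exact: idealMl].
Qed.

(** The linear form with coefficients (1, z, z^2, ...) is nonzero at each of finitely many
    given nonzero vectors if z avoids the roots of finitely many polynomials. *)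
Lemma generic_combination p (v : seq 'rV[K]_p) :
  exists c : 'I_p -> K, forall y, y \in v ->
    \sum_j c j * y 0 j = 0 -> forall j, y 0 j = 0.
Proof.
pose P := \prod_(y <- v | rVpoly y != 0) rVpoly y.
have P0 : P != 0.
  by rewrite /P; elim/big_rec: _ => [|y q yn qn]; rewrite ?oner_neq0 ?mulf_neq0.
have [z hz] := closed_nonrootP P P0.
exists (fun j => z ^+ j) => y yv hy j.
have [e|ne] := eqVneq (rVpoly y) 0; first by rewrite -coef_rVpoly_ord e coef0.
case/negP: hz; rewrite /P (big_rem y yv) /= ne rootM; apply/orP; left.
rewrite /root (@horner_coef_wide _ p) ?size_poly // -[X in _ == X]hy; apply/eqP.
by apply: eq_bigr => i _; rewrite coef_rVpoly_ord mulrC.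
Qed.

(** Taking homogeneous parts makes the quotients by X_l forms of degree E, and a
    large E serves all variables at once. *)
Lemma split_uniform (th : 'I_n -> A) (l : 'I_n) :
  homog_family th -> th l = 'X_l -> cofinite th ->
  exists E, exists a : 'I_n -> A,
    (forall i, a i \is E.-homog) /\
    forall i, ideal th [set~ l] ('X_i ^+ E.+1 - 'X_l * a i).
Proof.
move=> hth thl /choice[e he]; pose E := (\sum_i e i)%N.
have hE i : exists a, ideal th [set~ l] ('X_i ^+ E.+1 - a * 'X_l).
  have : ideal th setT ('X_i ^+ E.+1).
    have -> : E.+1 = (E.+1 - e i + e i)%N.
      by rewrite subnK // ltnW // ltnS /E (bigD1 i) //= leq_addr.
    by rewrite exprD; apply: idealMl.
  have -> : setT = l |: [set~ l] by apply/setP => j; rewrite !inE; case: eqP.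
  by rewrite -thl; apply: ideal_setU1; rewrite !inE eqxx.
have [a ha] := choice hE; exists E, (fun i => pihomog mdeg E (a i)).
split=> i; first exact: pihomogP.
have := ideal_pihomog E.+1 hth (ha i).
have hX k : ('X_k : A) \is 1.-homog by rewrite dhomogX /= mdeg1.
rewrite raddfB /= (pihomogMr _ _ (hX l)) /= subSS subn0 mulrC pihomog_dE //.
by have := dhomogMn E.+1 (hX i); rewrite mul1n.
Qed.

(** Comparing homogeneous parts, the part of degree k of the cofactor a is
    congruent to - X_l^k, and it is zero in high degree. *)
Lemma homogenize_unit (th : 'I_n -> A) (l : 'I_n) (S : {set 'I_n}) a :
  homog_family th -> ideal th S (1 - ('X_l - 1) * a) ->
  exists k, ideal th S ('X_l ^+ k).
Proof.
move=> hth h; exists (msize a).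
have hX : ('X_l : A) \is 1.-homog by rewrite dhomogX /= mdeg1.
have hd d := ideal_pihomog d hth h.
have hk k : ideal th S (pihomog mdeg k a + 'X_l ^+ k).
  elim: k => [|k IH].
    have := hd 0%N; rewrite mulrBl mul1r opprB addrA !raddfB raddfD /=.
    rewrite (pihomogMl _ _ hX) /= subr0 pihomog_dE ?dhomog1 //.
    by rewrite expr0 addrC.
  have -> : pihomog mdeg k.+1 a + 'X_l ^+ k.+1 =
    (pihomog mdeg k.+1 a - 'X_l * pihomog mdeg k a) +
     'X_l * (pihomog mdeg k a + 'X_l ^+ k) by rewrite exprS; ring.
  apply: idealD; last exact: idealMl.
  have := hd k.+1; rewrite mulrBl mul1r opprB addrA !raddfB raddfD /=.
  rewrite (pihomogMl _ _ hX) /= subSS subn0.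
  by rewrite (pihomog_ne0 _ (dhomog1 _ _)) // add0r.
have := hk (msize a); rewrite (_ : pihomog _ _ a = 0) ?add0r //.
rewrite pihomogE big_seq_cond big_pred0 // => m; apply/negP => /andP[ma /eqP em].
by have := msize_mdeg_lt ma; rewrite em ltnn.
Qed.

Lemma cofinite_replace (th : 'I_n -> A) l beta :
  homog_family th -> th l = 'X_l -> cofinite th ->
  (exists k, ideal (replace th l beta) setT ('X_l ^+ k)) ->
  cofinite (replace th l beta).
Proof.
move=> hth thl hcof [k hk] i.
have [E [a [_ ha]]] := split_uniform hth thl hcof.
exists (E.+1 * k)%N; rewrite exprM.
have hi : ideal (replace th l beta) setT ('X_i ^+ E.+1 - 'X_l * a i).
  apply: (@ideal_sub _ _ _ _ [set~ l]); first exact: subsetT.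
  by rewrite ideal_replace ?inE ?eqxx.
set x := _ ^+ E.+1 in hi *; set y := 'X_l * a i in hi.
have hy : ideal (replace th l beta) setT (y ^+ k).
  by rewrite exprMn; apply: idealMr.
by rewrite -[x ^+ k](subrK (y ^+ k)) subrXX; apply: idealD => //; apply: idealMr.
Qed.

(** Set X_l = 1. Modulo the other members of the family, what remains is finite
    over K, so it has finitely many zeros, and none of them is a common zero of G.
    A generic combination beta of G therefore vanishes at none of them, and the
    zero-dimensional Nullstellensatz makes beta a unit modulo the others and
    X_l - 1. After homogenization some power X_l^k is a multiple of beta modulo
    the others. As X_l is a non-zero-divisor modulo these, so is beta. *)
Lemma chain_step (th : 'I_n -> A) (l : 'I_n) (D p : nat) (G : 'I_p -> A) :
  strongly_regular th -> homog_family th -> th l = 'X_l -> cofinite th ->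
  (0 < D)%N -> (forall j, G j \is D.-homog) ->
  (forall xi : 'I_n -> K, (forall j, (G j).@[xi] = 0) -> forall i, xi i = 0) ->
  exists c : 'I_p -> K, let beta := \sum_j c j *: G j in
    strongly_regular (replace th l beta) /\ cofinite (replace th l beta).
Proof.
move=> sr hth thl hcof D0 hG hnz.
have [E [a [ha hE]]] := split_uniform hth thl hcof.
pose Th := ideal th [set~ l]; have iTh : is_ideal Th by apply: is_ideal_ideal.
pose J := adjoin Th ('X_l - 1); have iJ : is_ideal J by apply: is_ideal_adjoin.
have red := reduce_degree iTh ha hE.
have /choice[u hu] : forall i, exists u : {poly K},
    u != 0 /\ J (map_poly (@mpolyC n K) u).['X_i].
  by move=> i; have [u u0 hu] := dependent_powers 'X_i iJ red; exists u.
have [rs hrs] := choice (fun i => let: exist rs e := closed_field_poly_normal (u i) in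
   ex_intro (fun rs => u i = lead_coef (u i) *: \prod_(z <- rs) ('X - z%:P)) rs e).
pose all_roots := flatten [seq rs i | i <- enum 'I_n].
have rootP i z : root (u i) z -> z \in all_roots.
  move=> rz; apply/flattenP; exists (rs i); first by rewrite map_f ?mem_enum.
  by move: rz; rewrite (hrs i) rootZ ?lead_coef_eq0 ?(hu i).1 // root_prod_XsubC.
pose ev (f : {ffun 'I_n -> 'I_(size all_roots)}) : 'rV[K]_p :=
  \row_j (G j).@[fun i => nth 0 all_roots (f i)].
have [c hc] := generic_combination [seq ev f | f <- enum {: {ffun 'I_n -> 'I_(size all_roots)}}].
exists c => beta.
have hbeta : beta \is D.-homog by apply: rpred_sum => j _; apply: rpredZ.
have unit1 : adjoin J beta 1.
  apply: contrapT => h1.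
  have [||xi [xir xiJ]] := zero_dim_nullstellensatz (is_ideal_adjoin beta iJ) h1 (u := u).
  - by move=> i; apply: (hu i).1.
  - by move=> i; apply: adjoin_sub; apply: (hu i).2.
  have xi_in i : xi i \in all_roots by apply: rootP (xir i).
  have hidx i : (index (xi i) all_roots < size all_roots)%N by rewrite index_mem.
  pose f := [ffun i => Ordinal (hidx i)].
  have evE j : ev f 0 j = (G j).@[xi].
    by rewrite mxE; apply: meval_eq => i; rewrite ffunE nth_index.
  have xi0 := hnz xi; have Gj0 : forall j, (G j).@[xi] = 0.
    move=> j; rewrite -evE; apply: hc; first by rewrite map_f ?mem_enum.
    have := xiJ beta (adjoin_gen _ iJ); rewrite /beta raddf_sum /= => e0.
    by rewrite -[RHS]e0; apply: eq_bigr => k _; rewrite evE mevalZ.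
  have : J ('X_l - 1) by apply: adjoin_gen.
  move/(adjoin_sub beta)/xiJ; rewrite mevalB mevalXU meval1 xi0 // sub0r.
  by move/eqP; rewrite oppr_eq0 oner_eq0.
pose th' := replace th l beta.
have hth' : homog_family th'.
  by move=> i; rewrite /th' /replace; case: eqP => _; [exists D | apply: hth].
have subTh q : Th q -> ideal th' setT q.
  move=> hq; apply: (@ideal_sub _ _ _ _ [set~ l]); first exact: subsetT.
  by rewrite ideal_replace ?inE ?eqxx.
have hbeta' : ideal th' setT beta.
  have e : th' l = beta by rewrite /th' /replace eqxx.
  by rewrite -e; apply: ideal_gen; rewrite inE.
have [b [a' hab]] := unit1.
have [k hk] : exists k, ideal th' setT ('X_l ^+ k).
  apply: (homogenize_unit (a := a')) => //.
  have -> : 1 - ('X_l - 1) * a' = (1 - b * beta - a' * ('X_l - 1)) + b * beta.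
    by ring.
  by apply: idealD; [exact: subTh | exact: idealMl].
split; last by apply: cofinite_replace => //; exists k.
apply: (strongly_regular_replace hth sr D0 hbeta) => q hq.
have lN : l \notin [set~ l] by rewrite !inE eqxx.
have hk' : exists g, ideal th [set~ l] ('X_l ^+ k - g * beta).
  have eT : setT = l |: [set~ l] by apply/setP => j; rewrite !inE; case: eqP.
  move: hk; rewrite eT => /(ideal_setU1 lN)[g]; rewrite /th' ideal_replace //.
  by rewrite /replace eqxx; exists g.
have [g hg] := hk'.
have : ideal th [set~ l] ('X_l ^+ k * q).
  have -> : 'X_l ^+ k * q = q * ('X_l ^+ k - g * beta) + g * (beta * q) by ring.
  by apply: idealD; apply: idealMl.
elim: k {hk hk' hg} => [|k IH]; first by rewrite expr0 mul1r.
by rewrite exprS -mulrA -{1}thl => /(sr _ _ _ lN).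
Qed.

(** The variables form a regular family; exchange them one by one for
    combinations of the given forms. *)
Lemma regular_combinations (D p : nat) (G : 'I_p -> A) :
  (0 < D)%N -> (forall j, G j \is D.-homog) ->
  (forall xi : 'I_n -> K, (forall j, (G j).@[xi] = 0) -> forall i, xi i = 0) ->
  exists c : 'I_n -> 'I_p -> K,
    strongly_regular (fun i : 'I_n => \sum_j c i j *: G j).
Proof.
move=> D0 hG hnz.
have step k : (k <= n)%N -> exists c : 'I_n -> 'I_p -> K,
    let th := fun i : 'I_n => if (i < k)%N then \sum_j c i j *: G j else 'X_i in
    strongly_regular th /\ cofinite th.
  elim: k => [_|k IH lt].
    exists (fun _ _ => 0) => /=; split; first exact: vars_regular.
    by move=> i; exists 1%N; rewrite expr1; apply: ideal_gen; rewrite inE.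
  have [c [sr hcof]] := IH (ltnW lt).
  set th := (fun i => _) in sr hcof.
  have hth : homog_family th.
    move=> i; rewrite /th; case: ifP => _; last exact: vars_homog.
    exists D; first exact: D0.
    by apply: rpred_sum => j _; apply: rpredZ; apply: hG.
  have thl : th (Ordinal lt) = 'X_(Ordinal lt) by rewrite /th /= ltnn.
  have [c1 [sr1 cof1]] := chain_step sr hth thl hcof D0 hG hnz.
  exists (fun i => if i == Ordinal lt then c1 else c i) => th1.
  suff -> : th1 = replace th (Ordinal lt) (\sum_j c1 j *: G j) by split.
  apply/funext => i; rewrite /th1 /replace /th ltnS.
  have [->|ne] := eqVneq i (Ordinal lt); first by rewrite /= leqnn.
  by rewrite ltn_neqAle -[i == k :> nat]/(i == Ordinal lt) ne.
have [c [sr _]] := step n (leqnn n); exists c; move: sr.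
congr strongly_regular; apply/funext => i; by rewrite ltn_ord.
Qed.
End Chain.

(** * Dimensions of spaces of forms *)

Section Dimensions.
Variables (K : fieldType) (n : nat).
Notation A := {mpoly K[n.+1]}.
Notation H s := (dhomog n.+1 K s).

(** The count is for n + 1 variables, so that it is positive for all n. *)
Definition nforms s := 'C(s + n, n).

Lemma dim_forms s : \dim {:H s} = nforms s.
Proof. by rewrite dimvf /dim /= /nforms -bin_sub ?leq_addr // addKn. Qed.

Definition homog_part s (p : A) : H s := DHomog (pihomogP mdeg s p).

Fact homog_part_linear s : linear (homog_part s).
Proof. by move=> c p q; apply: val_inj; rewrite /= linearP. Qed.
HB.instance Definition _ s := GRing.isLinear.Build K A (H s) _ (homog_part s)
  (homog_part_linear s).

Lemma homog_partK s (p : A) : p \is s.-homog -> val (homog_part s p) = p.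
Proof. exact: pihomog_dE. Qed.

Definition mulby s sg (g : A) (q : H s) : H sg := homog_part sg (g * val q).

Fact mulby_linear s sg g : linear (@mulby s sg g).
Proof. by move=> c p q; rewrite /mulby -linearP /= mulrDr -scalerAr. Qed.
HB.instance Definition _ s sg g := GRing.isLinear.Build K (H s) (H sg) _
  (@mulby s sg g) (@mulby_linear s sg g).

Definition mulH s sg g : 'Hom(H s, H sg) := linfun (@mulby s sg g).

Lemma mulHE s sg g q : mulH s sg g q = homog_part sg (g * val q).
Proof. by rewrite lfunE. Qed.

Lemma val_mulH s D g q : g \is D.-homog -> val (mulH s (s + D) g q) = g * val q.
Proof.
move=> hg; rewrite mulHE homog_partK // mulrC; apply: dhomogM => //.
exact: dhomog_is_dhomog.
Qed.

(** Inclusion-exclusion truncated after two terms. Multiplication by th_k is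
    injective, and a multiple of th_k in the ideal of the previous members has its
    cofactor in that ideal, so that the intersections are of size at most
    k times the number of forms of degree s. *)
Lemma regular_sequence_dim (th : 'I_n.+1 -> A) D s k :
  strongly_regular th -> (forall i, th i \is D.-homog) -> (k <= n.+1)%N ->
  (k * nforms (s + D) <=
   \dim (\sum_(i < n.+1 | (i < k)%N) limg (mulH (s + D) (s + D + D) (th i)))%VS
    + 'C(k, 2) * nforms s)%N.
Proof.
move=> sr hth; elim: k => [|k IH] lt; first by rewrite mul0n.
have := IH (ltnW lt); set W := (\sum_(i < _ | _) _)%VS => {}IH.
pose l := Ordinal lt.
have -> : (\sum_(i < n.+1 | (i < k.+1)%N) limg (mulH (s + D) (s + D + D) (th i)))%VS
    = (W + limg (mulH (s + D) (s + D + D) (th l)))%VS.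
  rewrite (bigD1 l) //= addvC; congr (_ + _)%VS; apply: eq_bigl => i.
  by rewrite ltnS -val_eqE /= ltn_neqAle andbC.
set T := limg _.
pose W' := (\sum_(i < n.+1 | (i < k)%N) limg (mulH s (s + D) (th i)))%VS.
have dT : \dim T = nforms (s + D).
  rewrite limg_dim_eq ?dim_forms //; apply/eqP; rewrite -subv0.
  apply/subvP => q; rewrite memv_cap memv0 memv_ker => /andP[_ /eqP q0].
  have : ideal th set0 (th l * val q).
    by rewrite -(val_mulH _ (hth l)) q0; apply: ideal0.
  have l0 : l \notin set0 by rewrite inE.
  move/(sr _ _ _ l0) => [b hb]; apply/eqP/val_inj.
  by rewrite /= hb big_set0.
have dW' : (\dim W' <= k * nforms s)%N.
  rewrite /W'; apply: leq_trans (dimv_leq_sum _ _ _) _.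
  apply: (@leq_trans (\sum_(i < n.+1 | (i < k)%N) nforms s)%N).
    apply: leq_sum => i _; rewrite -(dim_forms s).
    by rewrite -(limg_ker_dim (mulH s (s + D) (th i)) fullv) leq_addl.
  rewrite sum_nat_const leq_mul2r; apply/orP; right.
  rewrite -sum1_card -(big_ord_widen _ (fun=> 1%N) (ltnW lt)).
  by rewrite sum_nat_const card_ord muln1.
have cap : (\dim (W :&: T) <= \dim W')%N.
  apply: (@leq_trans (\dim (mulH (s + D) (s + D + D) (th l) @: W')%VS)); last first.
    by rewrite -(limg_ker_dim (mulH (s + D) (s + D + D) (th l)) W') leq_addl.
  apply/dimvS/subvP => v; rewrite memv_cap => /andP[vW /memv_imgP[q _ ev]].
  rewrite ev; apply: memv_img.
  have [q' hq' ev'] := memv_sumP vW.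
  pose S := [set i : 'I_n.+1 | (i < k)%N].
  have : ideal th S (th l * val q).
    rewrite -(val_mulH _ (hth l)) -ev ev' raddf_sum /=.
    rewrite (eq_bigl (fun i => i \in S)); last by move=> i; rewrite inE.
    apply: ideal_sum => i iS; have /hq' : (i < k)%N by rewrite inE in iS.
    move=> /memv_imgP[b _ ->]; rewrite (val_mulH _ (hth i)).
    by rewrite mulrC; apply/idealMl/ideal_gen.
  have lS : l \notin S by rewrite inE ltnn.
  move/(sr _ _ _ lS) => [b hb].
  have -> : q = \sum_(i in S) mulH s (s + D) (th i) (homog_part s (b i)).
    apply: val_inj; rewrite raddf_sum /= -{1}(pihomog_dE (dhomog_is_dhomog q)) /= hb.
    rewrite raddf_sum /=; apply: eq_bigr => i _.
    rewrite (pihomogMr _ _ (hth i)) leq_addl addnK -/(val _) (val_mulH _ (hth i)).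
    by rewrite mulrC.
  apply: memv_suml => i iS.
  have iW : (limg (mulH s (s + D) (th i)) <= W')%VS.
    by apply: (sumv_sup i) => //; rewrite inE in iS.
  by apply: (subvP iW); apply: memv_img; apply: memvf.
have := dimv_sum_cap W T; rewrite dT binS bin1.
move: (\dim _) (\dim _) (\dim W) (\dim W') 'C(k, 2) IH cap dW'.
move: (nforms _) (nforms _) => x y z1 z2 z3 z4 z5; clear; nia.
Qed.
End Dimensions.

Section Macaulay.
Variables (K : closedFieldType) (n : nat).
Notation A := {mpoly K[n.+1]}.
Notation H s := (dhomog n.+1 K s).
Notation nforms := (nforms n).
Import VectorInternalTheory.

Lemma nformsS s : (s.+1 * nforms s.+1 = (n + s.+1) * nforms s)%N.
Proof.
have h k : nforms k = 'C(n + k, k).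
  by rewrite /nforms addnC -bin_sub ?leq_addr // addKn.
by rewrite !h -mul_bin_diag addnS.
Qed.

Lemma nforms_gt0 s : (0 < nforms s)%N.
Proof. by rewrite bin_gt0 leq_addl. Qed.

Lemma nforms_le_exp s k L : n = (L * s)%N -> (0 < s)%N ->
  (nforms (s + k) <= L.+1 ^ k * nforms s)%N.
Proof.
move=> en s0; elim: k => [|k IH]; first by rewrite addn0 mul1n.
rewrite -(leq_pmul2l (ltn0Sn (s + k))) addnS nformsS expnS.
apply: leq_trans (leq_mul (leqnn _) IH) _.
rewrite !mulnA leq_mul2r; apply/orP; right; rewrite leq_mul2r; apply/orP; right.
by rewrite en; nia.
Qed.

Lemma exp_le_nforms s k L s0 : n = (L * s0)%N -> (s + k <= s0)%N ->
  (L ^ k * nforms s <= nforms (s + k))%N.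
Proof.
move=> en; elim: k => [|k IH] le; first by rewrite addn0 mul1n.
rewrite -(leq_pmul2l (ltn0Sn (s + k))) addnS nformsS.
apply: (@leq_trans ((n + (s + k).+1) * (L ^ k * nforms s))); last first.
  by rewrite leq_mul2l IH ?orbT //; lia.
rewrite expnS !mulnA leq_mul2r; apply/orP; right; rewrite leq_mul2r; apply/orP; right.
by rewrite en; nia.
Qed.

(** Its row space is the degree sg part of the ideal of g, when the g_j have degree
    sg - s; the point of working with the matrix is its linearity in g. *)
Definition macaulay m s sg (g : 'I_m -> A) :
    'M[K]_(#|{: 'I_m * 'I_(\dim {:H s})}|, dim (H sg)) :=
  \matrix_k v2r (mulH s sg (g (enum_val k).1) (vbasis {:H s})`_((enum_val k).2 : 'I_(\dim {:H s}))).

Lemma row_macaulay m s sg (g : 'I_m -> A) k :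
  row k (macaulay s sg g) =
  v2r (mulH s sg (g (enum_val k).1) (vbasis {:H s})`_((enum_val k).2 : 'I_(\dim {:H s}))).
Proof. exact: rowK. Qed.

Lemma macaulay_linear m s sg N (t : 'I_N -> K) (g : 'I_N -> 'I_m -> A) :
  \sum_i t i *: macaulay s sg (g i) = macaulay s sg (fun j => \sum_i t i *: g i j).
Proof.
apply/row_matrixP => k; rewrite row_macaulay linear_sum /=.
rewrite mulHE mulr_suml !linear_sum /=; apply: eq_bigr => i _.
by rewrite linearZ /= row_macaulay mulHE -scalerAl !linearZ.
Qed.

Lemma mem_mx2vs (vT : vectType K) p (M : 'M[K]_(p, dim vT)) v :
  (v \in mx2vs M) = (v2r v <= M)%MS.
Proof. by rewrite memvE /subsetv !mx2vsK. Qed.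

Lemma rank_macaulay m s sg (g : 'I_m -> A) :
  \rank (macaulay s sg g) = \dim (\sum_j limg (mulH s sg (g j)))%VS.
Proof.
have <- : \dim (mx2vs (macaulay s sg g)) = \rank (macaulay s sg g).
  by rewrite /dimv mx2vsK.
congr (\dim _); apply/eqP; rewrite eqEsubv; apply/andP; split; last first.
  apply/subv_sumP => j _; apply/subvP => v /memv_imgP[q _ ->].
  rewrite (coord_vbasis (memvf q)) linear_sum; apply: memv_suml => b _.
  rewrite linearZ; apply: memvZ; rewrite mem_mx2vs.
  have := row_sub (enum_rank (j, b)) (macaulay s sg g).
  by rewrite row_macaulay enum_rankK.
apply/subvP => v; rewrite mem_mx2vs => /submxP[c ec].
rewrite -(v2rK v) ec mulmx_sum_row linear_sum; apply: memv_suml => k _.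
rewrite linearZ /=; apply: memvZ; rewrite row_macaulay v2rK.
have h : (limg (mulH s sg (g (enum_val k).1)) <= \sum_j limg (mulH s sg (g j)))%VS.
  exact: sumv_sup.
by apply: (subvP h); apply: memv_img; apply: memvf.
Qed.

Lemma dim_limg_mulH s sg g : (\dim (limg (mulH s sg (g : A))) <= nforms s)%N.
Proof. by rewrite -(dim_forms K n s) -(limg_ker_dim (mulH s sg g) fullv) leq_addl. Qed.

Lemma nforms_mono s s' : (s <= s')%N -> (nforms s <= nforms s')%N.
Proof. by move=> le; apply: leq_bin2l; rewrite leq_add2r. Qed.

(** The degree sg part of an ideal generated by forms h_i of positive degree is a sum
    of images of spaces of forms of degree less than sg. *)
Lemma dim_small_ideal m s sg (g : 'I_m -> A) (I : finType) (h : I -> A) :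
  homog_family h -> (forall j, ideal h setT (g j)) ->
  (\dim (\sum_j limg (mulH s sg (g j)))%VS <= #|I| * nforms sg.-1)%N.
Proof.
move=> hh hg; have /choice[e he] : forall i, exists e, (0 < e)%N /\ h i \is e.-homog.
  by move=> i; have [e e0 ei] := hh i; exists e.
apply: (@leq_trans (\dim (\sum_(i : I | (e i <= sg)%N)
    limg (mulH (sg - e i) sg (h i)))%VS)).
  apply/dimvS/subv_sumP => j _; apply/subvP => v /memv_imgP[q _ ->].
  have [b eb] := hg j; rewrite mulHE eb mulr_suml linear_sum /= big_mkcond /=.
  apply: memv_suml => i _; rewrite in_setT.
  have -> : b i * h i * val q = h i * (b i * val q) by ring.
  have [le|lt] := leqP (e i) sg; last first.
    suff -> : homog_part sg (h i * (b i * val q)) = 0 by apply: mem0v.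
    by apply: val_inj; rewrite /= (pihomogMl _ _ (he i).2) leqNgt lt.
  have -> : homog_part sg (h i * (b i * val q)) =
      mulH (sg - e i) sg (h i) (homog_part (sg - e i) (b i * val q)).
    by apply: val_inj; rewrite mulHE /= !(pihomogMl _ _ (he i).2) le pihomog_id.
  have sub : (limg (mulH (sg - e i) sg (h i)) <= \sum_(i : I | (e i <= sg)%N)
    limg (mulH (sg - e i) sg (h i)))%VS by apply: (sumv_sup i).
  by apply: (subvP sub); apply: memv_img; apply: memvf.
apply: leq_trans (dimv_leq_sum _ _ _) _.
apply: (@leq_trans (\sum_(i : I) nforms sg.-1)); last by rewrite sum_nat_const.
rewrite big_mkcond; apply: leq_sum => i _; case: ifP => // _.
apply: leq_trans (dim_limg_mulH _ _ _) _; apply: nforms_mono.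
by have := (he i).1; case: (e i) => // k _; rewrite -subn1 leq_sub2l.
Qed.
End Macaulay.

(** * Common zeros of the polar forms on small subspaces *)

(** The arithmetic of [meets_small_subspaces]. There P, P', P1 count forms of
    degree L^D, L^D - D and L^D + D - 1 in a number of variables equal to L^(D+1) + 1, and
    Rk is the dimension of an ideal in degree L^D + D. A regular sequence of
    length M = L^D gives 2 Rk >= (M + 1) P, an ideal with 2r generators
    gives 3 Rk <= 8 r P1, and L is chosen such that 16 r P1 <= M P. *)
Lemma dimension_clash D r q W Rk P1 P P' (L := (8 * r * 2 ^ D)%N) (M := (L ^ D)%N) :
  (0 < D)%N -> (0 < r)%N -> (3 < q)%N -> (W <= Rk)%N ->
  (q * Rk <= q * (r.*2 * P1) + Rk)%N -> (M * P <= W + 'C(M, 2) * P')%N ->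
  (M * P' <= P)%N -> (P1 <= L.+1 ^ D.-1 * P)%N -> (0 < P)%N -> False.
Proof.
move=> D0 r0 q3 WR hR dW h1 h2 P0.
have hR3 : (3 * Rk <= 8 * (r * P1))%N.
  have : (q * Rk <= q * (2 * (r * P1)) + Rk)%N.
    by move: hR; rewrite -doubleMl -mul2n.
  move: q3 (r * P1)%N => {dW h1 h2 WR hR}; clear; nia.
have L0 : (0 < L)%N by rewrite !muln_gt0 r0 expn_gt0.
have M0 : (0 < M)%N by rewrite expn_gt0 L0.
have hC : (2 * ('C(M, 2) * P') <= M.-1 * P)%N.
  apply: (@leq_trans (M.-1 * (M * P'))); last by rewrite leq_mul2l h1 orbT.
  rewrite !mulnA leq_mul2r; apply/orP; right; rewrite bin2 mulnC muln2.
  by rewrite [X in (_ <= X)%N]mulnC -[X in (_ <= X)%N]odd_double_half leq_addl.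
have hP : (16 * (r * P1) <= M * P)%N.
  apply: (@leq_trans (16 * (r * (L.+1 ^ D.-1 * P)))); first by rewrite !leq_mul.
  rewrite !mulnA leq_mul2r; apply/orP; right.
  apply: (@leq_trans (16 * r * (2 * L) ^ D.-1)).
    rewrite leq_mul2l; apply/orP; right; case: D.-1 => // e.
    by rewrite leq_exp2r // mul2n -addnn -addn1 leq_add2l.
  have -> : M = (16 * r * (2 * L) ^ D.-1)%N.
    rewrite expnMn mulnA /M -[in LHS](prednK D0) expnS {1}/L -[in LHS](prednK D0) expnS.
    by congr (_ * _)%N; rewrite /L; ring.
  by [].
move: (r * P1)%N ('C(M, 2) * P')%N hC hP hR3 WR dW M0 P0; clear; nia.
Qed.

Section Polars.
Variable K : fieldType.

(** Up to a factor (D + 2)(D + 1), this is the polarization of f at (t, e_j, x, ..., x).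
    It is defined as the gradient in x of the derivative of f in the direction t, to
    which the Leibniz rule applies. *)
Definition polar m (f : {mpoly K[m]}) (t : 'I_m -> K) (j : 'I_m) : {mpoly K[m]} :=
  (\sum_i t i *: f^`M(i))^`M(j).

Lemma polarE m (f : {mpoly K[m]}) t j :
  polar f t j = \sum_i t i *: f^`M(i)^`M(j).
Proof. by rewrite /polar linear_sum; apply: eq_bigr => i _; rewrite linearZ. Qed.

Lemma dhomog_mderiv m (f : {mpoly K[m]}) d i :
  f \is d.+1.-homog -> f^`M(i) \is d.-homog.
Proof.
move=> hf; apply/dhomogP => k; rewrite mcoeff_msupp mcoeff_mderiv => h.
have : (k + U_(i))%MM \in msupp f.
  by rewrite mcoeff_msupp; apply: contra h => /eqP ->; rewrite mul0rn.
by move/(dhomog_mf hf) => /=; rewrite mdegD mdeg1 addn1 => -[].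
Qed.

Lemma dhomog_comp m k (p : {mpoly K[m]}) (lq : m.-tuple {mpoly K[k]}) d :
  (forall i, tnth lq i \is 1.-homog) -> p \is d.-homog -> p \mPo lq \is d.-homog.
Proof.
move=> hl hp; rewrite comp_mpolyEX big_seq; apply: rpred_sum => e ep.
apply: rpredZ; have <- : mdeg e = d := dhomog_mf hp ep.
rewrite comp_mpolyX mdegE.
apply: dhomog_big_prod => i _; rewrite -[X in X.-homog]mul1n.
exact: dhomogMn.
Qed.

(** Restriction of forms to the row space of phi, with the coordinates given by the
    rows. *)
Definition substM m N (phi : 'M[K]_(N, m)) : {mpoly K[m]} -> {mpoly K[N]} :=
  comp_mpoly [tuple \sum_l phi l i *: 'X_l | i < m].

HB.instance Definition _ m N phi := GRing.RMorphism.copy (@substM m N phi)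
  (comp_mpoly [tuple \sum_l phi l i *: 'X_l | i < m]).
HB.instance Definition _ m N phi := GRing.Linear.copy (@substM m N phi)
  (comp_mpoly [tuple \sum_l phi l i *: 'X_l | i < m]).

Lemma dhomog_substM m N (phi : 'M[K]_(N, m)) p d :
  p \is d.-homog -> substM phi p \is d.-homog.
Proof.
apply: dhomog_comp => i; rewrite tnth_mktuple; apply: rpred_sum => l _.
by apply: rpredZ; rewrite dhomogX /= mdeg1.
Qed.

Lemma meval_substM m N (phi : 'M[K]_(N, m)) p (u : 'rV[K]_N) :
  (substM phi p).@[fun l => u 0 l] = p.@[fun i => (u *m phi) 0 i].
Proof.
rewrite comp_mpoly_meval; apply: meval_eq => i; rewrite tnth_mktuple raddf_sum.
by rewrite mxE; apply: eq_bigr => l _; rewrite /= mevalZ mevalXU mulrC.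
Qed.

(** Decompositions over the field itself, so that extending scalars is left to the
    very end; stated with a bound in order to be monotonic in r. *)
Definition small_rank m (g : {mpoly K[m]}) (r : nat) := exists2 r', (r' <= r)%N &
  exists L R : 'I_r' -> {mpoly K[m]},
    (forall i, homog_pos (L i) /\ homog_pos (R i)) /\ g = \sum_i L i * R i.

End Polars.

Section SmallSubspaces.
Variable K : closedFieldType.

(** By the Leibniz rule the gradient of sum L_i R_i is in the ideal of the L_i
    and R_i together. *)
Lemma polar_in_small_ideal m N (phi : 'M[K]_(N.+1, m)) (f : {mpoly K[m]}) a r s sg :
  small_rank (\sum_i a i *: f^`M(i)) r ->
  (\rank (macaulay s sg (fun j => substM phi (polar f a j))) <= r.*2 * nforms N sg.-1)%N.
Proof.
move=> [r' ler [L [R [hLR e]]]]; rewrite rank_macaulay.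
pose h (i : 'I_r' + 'I_r') := substM phi (match i with inl i => L i | inr i => R i end).
apply: (@leq_trans (#|{: 'I_r' + 'I_r'}| * nforms N sg.-1)); last first.
  by rewrite card_sum card_ord leq_mul2r addnn leq_double ler orbT.
apply: (@dim_small_ideal _ _ _ _ _ _ _ h).
  by move=> [] i; have [[e1 h1 h2] [e2 h3 h4]] := hLR i; [exists e1 | exists e2];
    rewrite // /h; apply: dhomog_substM.
move=> j; rewrite /polar e (linear_sum (mderiv j)) (linear_sum (substM phi)) /=; apply: ideal_sum => i _.
rewrite mderivM rmorphD !rmorphM; apply: idealD.
  by apply: idealMl; apply: (ideal_gen h (S := setT) (j := inr i)); rewrite inE.
by apply: idealMr; apply: (ideal_gen h (S := setT) (j := inl i)); rewrite inE.
Qed.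

(** Otherwise some combinations of the restricted polar forms are a regular sequence.
    Its ideal is a lower bound for the rank of a matrix at t, whereas on the grid that
    rank is bounded by the size of an ideal with 2r generators. *)
Lemma meets_small_subspaces m D r (f : {mpoly K[m]}) (S : seq K) :
  (0 < D)%N -> (0 < r)%N -> uniq S -> (3 < size S)%N -> f \is D.+2.-homog ->
  (forall a : 'I_m -> K, (forall i, a i \in S) -> small_rank (\sum_i a i *: f^`M(i)) r) ->
  let L := (8 * r * 2 ^ D)%N in let N := (L * L ^ D)%N in
  forall (t : 'I_m -> K) (phi : 'M[K]_(N.+1, m)), exists2 u : 'rV[K]_N.+1,
    u != 0 & forall j, (polar f t j).@[fun i => (u *m phi) 0 i] = 0.
Proof.
move=> D0 r0 uS S3 hf hS L N t phi; apply: contrapT => hn.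
pose g a j := substM phi (polar f a j); pose M := (L ^ D)%N.
have L2 : (1 < L)%N.
  rewrite /L; have : (0 < 2 ^ D)%N by rewrite expn_gt0. 
  by move: r0; clear; nia.
have DM : (D < M)%N by apply: ltn_expl.
pose s' := (M - D)%N; pose s := (s' + D)%N.
have es : s = M by rewrite /s subnK // ltnW.
have hg a j : g a j \is D.-homog.
  apply: dhomog_substM; rewrite polarE; apply: rpred_sum => i _; apply: rpredZ.
  by do 2!apply: dhomog_mderiv.
have [c sr] : exists c : 'I_N.+1 -> 'I_m -> K,
    strongly_regular (fun i : 'I_N.+1 => \sum_j c i j *: g t j).
  apply: (regular_combinations D0 (hg t)) => xi hxi i0.
  apply/eqP/negP => /negP xi0; apply: hn; exists (\row_i xi i).
    by apply: contra_neq xi0 => /rowP/(_ i0); rewrite !mxE.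
  move=> j; rewrite -meval_substM; rewrite -[RHS](hxi j); apply: meval_eq => l.
  by rewrite mxE.
pose th i := \sum_j c i j *: g t j.
have hth i : th i \is D.-homog by apply: rpred_sum => j _; apply: rpredZ.
have MN : (M <= N.+1)%N.
  by rewrite /M /N ltnW // ltnS leq_pmull // ltnW.
have := regular_sequence_dim s' sr hth MN.
rewrite -/s; set W := (\sum_(i < _ | _) _)%VS => dW.
have WR : (\dim W <= \rank (macaulay s (s + D) (g t)))%N.
  rewrite rank_macaulay; apply/dimvS/subv_sumP => i _.
  apply/subvP => v /memv_imgP[q _ ->]; rewrite mulHE mulr_suml linear_sum.
  apply: memv_suml => j _; rewrite -scalerAl linearZ /=; apply: memvZ.
  rewrite -mulHE; apply: (subvP (sumv_sup j _ (subvv _))) => //.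
  by apply: memv_img; apply: memvf.
pose Rk := \rank (macaulay s (s + D) (g t)).
have gE a j : g a j = \sum_i a i *: substM phi (f^`M(i)^`M(j)).
  by rewrite /g polarE linear_sum; apply: eq_bigr => i _; rewrite linearZ.
have macE a : macaulay s (s + D) (g a) =
    \sum_i a i *: macaulay s (s + D) (fun j => substM phi (f^`M(i)^`M(j))).
  by rewrite macaulay_linear; congr macaulay; apply/funext => j; rewrite gE.
have := @rank_grid K m _ _ (fun i => macaulay s (s + D) (fun j => substM phi (f^`M(i)^`M(j))))
  S (r.*2 * nforms N (s + D).-1) uS (ltn_trans _ S3) _ t.
rewrite -macE -/Rk => hR.
have {}hR : (size S * Rk <= size S * (r.*2 * nforms N (s + D).-1) + Rk)%N.
  apply: hR => // a aS; rewrite -macE; apply: polar_in_small_ideal; exact: hS.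
have h1 : (L ^ D * nforms N s' <= nforms N s)%N.
  by apply: (@exp_le_nforms _ _ _ _ s) => //; rewrite es.
have h2 : (nforms N (s + D).-1 <= L.+1 ^ D.-1 * nforms N s)%N.
  rewrite -subn1 -addnBA // subn1; apply: nforms_le_exp; rewrite ?es //.
  exact: leq_ltn_trans DM.
exact: dimension_clash D0 r0 S3 WR hR dW h1 h2 (nforms_gt0 N s).
Qed.
End SmallSubspaces.

(** * Points on large cones *)

Section Interpolation.
Variables (K : fieldType) (W : vectType K) (T : Type) (E : T -> {linear W -> K^o}).

(** Evaluations separate W, so their coordinate vectors span, and a basis among them
    has a dual basis. *)
Lemma interpolation : (forall w, (forall x, E x w = 0) -> w = 0) ->
  exists (x : 'I_(\dim {:W}) -> T) (w : 'I_(\dim {:W}) -> W),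
    forall i j, E (x i) (w j) = (i == j)%:R.
Proof.
move=> sep; set h := \dim {:W}.
pose e (x : T) : 'rV[K]_h := \row_i E x (vbasis {:W})`_i.
have eE x (c : 'cV[K]_h) :
    (e x *m c) 0 0 = E x (\sum_i c i 0 *: (vbasis {:W})`_i).
  rewrite mxE linear_sum; apply: eq_bigr => i _.
  by rewrite linearZ mxE mulrC.
have step k : (k <= h)%N -> exists M : 'M[K]_(k, h),
    (forall i, exists x, row i M = e x) /\ row_free M.
  elim: k => [|k IH] lt; first by exists 0; split; [case | rewrite -row_leq_rank].
  have [M [hM fM]] := IH (ltnW lt).
  have : (0 < \rank (kermx M^T))%N.
    by rewrite mxrank_ker mxrank_tr subn_gt0 (eqP fM).
  rewrite lt0n mxrank_eq0 => /rowV0Pn[u uk u0].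
  have Mu : M *m u^T = 0.
    by apply: trmx_inj; rewrite trmx_mul trmxK trmx0; apply/sub_kermxP.
  pose w := \sum_i u^T i 0 *: (vbasis {:W})`_i.
  have w0 : w != 0.
    apply: contraNneq u0 => w0; apply/eqP/rowP => i; rewrite mxE.
    have /freeP/(_ (fun i => u 0 i)) := basis_free (vbasisP {:W}).
    by apply; rewrite -[RHS]w0; apply: eq_bigr => j _; rewrite mxE.
  have [y hy] : exists y, E y w != 0.
    apply: contrapT => hn; case/eqP: w0; apply: sep => x'.
    by apply/eqP/negPn/negP => hx; apply: hn; exists x'.
  have {}hy : (e y *m u^T) 0 0 != 0 by rewrite eE.
  rewrite -addn1; exists (col_mx M (e y)); split=> [i|].
    case: (split_ordP i) => j -> ; rewrite ?rowKu ?rowKd //.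
    by exists y; rewrite row_id.
  rewrite -kermx_eq0; apply/rowV0P => v /sub_kermxP.
  rewrite -(hsubmxK v) mul_row_col => vM.
  have v2 : rsubmx v = 0.
    apply/rowP => j; rewrite !ord1 [RHS]mxE.
    have : rsubmx v 0 0 * (e y *m u^T) 0 0 = 0.
      have := congr1 (fun M => (M *m u^T) 0 0) vM; rewrite mul0mx mulmxDl.
      rewrite -mulmxA Mu mulmx0 add0r -mulmxA [LHS]mxE big_ord1 => ->.
      by rewrite mxE.
    by move/eqP; rewrite mulf_eq0 (negPf hy) orbF => /eqP.
  move: vM; rewrite v2 mul0mx addr0 => /sub_kermxP.
  move: fM; rewrite -kermx_eq0 => /eqP ->; rewrite submx0 => /eqP ->.
  by rewrite row_mx0.
have [M [/choice[x hx] fM]] := step h (leqnn _).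
have uM : M \in unitmx by rewrite -row_free_unit.
exists x, (fun j => \sum_i invmx M i j *: (vbasis {:W})`_i) => i j.
transitivity ((M *m invmx M) i j); last by rewrite mulmxV // mxE.
have := eE (x i) (col j (invmx M)); rewrite -hx mxE => e1.
rewrite mxE; transitivity (\sum_k row i M 0 k * col j (invmx M) k 0).
  by rewrite e1; congr (E (x i) _); apply: eq_bigr => k _; rewrite mxE.
by apply: eq_bigr => k _; rewrite !mxE.
Qed.
End Interpolation.


Section Points.
Variables (K : closedFieldType).

(** A trivial grid suffices here: on some line through the origin p is nonzero. *)
Lemma nonroot n (p : {mpoly K[n]}) : p != 0 -> exists c, p.@[c] != 0.
Proof.
move=> /(@schwartz_zippel_order _ _ [:: 0]) []// a [w [m [_ _ hm]]].
set q := mmap _ _ p in hm; have q0 : q != 0.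
  by apply: contraNneq hm => ->; rewrite coef0.
have [x hx] := closed_nonrootP q q0; exists (fun i => a i + w i * x).
apply: contraNneq hx => p0; rewrite /root /q -horner_evalE -p0.
rewrite /meval /mmap raddf_sum; apply/eqP/eq_bigr => m' _.
rewrite /= horner_evalE hornerM hornerC; congr (_ * _).
rewrite /mmap1 horner_prod; apply: eq_bigr => i _.
by rewrite horner_exp hornerD hornerC hornerZ hornerX.
Qed.

Lemma meval_homogZ n (p : {mpoly K[n]}) e (c : 'rV[K]_n) x : p \is e.-homog ->
  p.@[fun i => (x *: c) 0 i] = x ^+ e * p.@[fun i => c 0 i].
Proof.
move=> hp; rewrite !mevalE mulr_sumr; apply: eq_big_seq => m mp.
have <- : mdeg m = e := dhomog_mf hp mp.
rewrite mdegE -prodrXr mulrCA -big_split; congr (_ * _).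
by apply: eq_bigr => i _; rewrite mxE exprMn.
Qed.

(** Take a linear projection that is injective at the origin of X, to a space of
    minimal dimension k. Its kernel meets X in the origin only, hence has
    dimension at most N. If
    a form h vanished on the image of X, then projecting further along a direction c
    with h(c) nonzero would contradict minimality: the image is a cone on which h vanishes,
    so it does not contain c, and the further projection is still injective there. *)
Lemma noether_cone m N (X : 'rV[K]_m -> Prop) :
  (forall x (c : K), X x -> X (c *: x)) ->
  (forall phi : 'M[K]_(N.+1, m), exists2 u : 'rV_N.+1, u != 0 & X (u *m phi)) ->
  exists k (Y : 'M[K]_(m, k)), (m <= N + k)%N /\
    forall e (h : {mpoly K[k]}), (0 < e)%N -> h \is e.-homog ->
      (forall x, X x -> h.@[fun i => (x *m Y) 0 i] = 0) -> h = 0.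
Proof.
move=> cone big.
pose proper k := `[< exists Y : 'M[K]_(m, k), forall x, X x -> x *m Y = 0 -> x = 0 >].
have : exists k, proper k.
  by exists m; apply/asboolP; exists 1%:M => x _; rewrite mulmx1.
move/ex_minnP => [k /asboolP[Y hY] kmin]; exists k, Y; split.
  rewrite leqNgt; apply/negP => lt.
  have rk : (N < \rank (kermx Y))%N.
    rewrite mxrank_ker ltn_subRL; apply: leq_ltn_trans lt.
    by rewrite addnC leq_add2l rank_leq_col.
  pose B := row_base (kermx Y); pose P : 'M[K]_(N.+1, _) := pid_mx N.+1 *m B.
  have [u u0 Xu] := big P.
  have fP : row_free P.
    by rewrite /row_free mxrankMfree ?row_base_free // rank_pid_mx.
  case/eqP: u0; apply: (row_free_inj fP); rewrite mul0mx; apply: hY => //.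
  have BY : B *m Y = 0 by apply/sub_kermxP; rewrite eq_row_base.
  by rewrite -(mulmxA u P Y) -(mulmxA _ B Y) BY !mulmx0.
move=> e h e0 hh hX; apply/eqP/negP => /negP /nonroot[c' hc'].
pose c : 'rV[K]_k := \row_i c' i; have hc : h.@[fun i => c 0 i] != 0.
  by apply: contra_neq hc' => <-; apply: meval_eq => i; rewrite mxE.
have c0 : c != 0.
  apply: contraNneq hc => c0; apply/eqP.
  have := meval_homogZ c 0 hh; rewrite scale0r expr0n eqn0Ngt e0 mul0r => <-.
  by apply: meval_eq => i; rewrite c0.
pose C := col_base (cokermx c).
have rC : (\rank (cokermx c) < k)%N.
  rewrite mxrank_coker rank_rV c0; case: (k) c c0 {hc C} => [|k'] c; last by rewrite subn1.
  by rewrite thinmx0 eqxx.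
suff /kmin : proper (\rank (cokermx c)) by rewrite leqNgt rC.
apply/asboolP; exists (Y *m C) => x Xx; rewrite mulmxA => xC.
have : (x *m Y <= c)%MS.
  by rewrite submxE -(mulmx_base (cokermx c)) mulmxA xC mul0mx.
case/sub_rVP => a xY; apply: hY => //.
have := hX x Xx; rewrite xY (meval_homogZ _ _ hh) => /eqP.
rewrite mulf_eq0 (negPf hc) orbF expf_eq0 e0 => /eqP a0.
by rewrite ?xY a0 scale0r.
Qed.

Lemma nforms_mono_vars n n' mu : (n <= n')%N -> (nforms n mu <= nforms n' mu)%N.
Proof.
have e l : nforms l mu = 'C(mu + l, mu).
  by rewrite /nforms -[in RHS]bin_sub ?leq_addr // addKn.
by move=> le; rewrite !e; apply: leq_bin2l; rewrite leq_add2l.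
Qed.

(** Forms in the projected coordinates are separated by the points of the cone. The
    number of points is the one of a space of dimension exactly m + 1 - N,
    whatever the dimension of the projection is, because the count has to be the same
    for all cones. *)
Lemma dual_points m N mu (X : 'rV[K]_m.+1 -> Prop) : (0 < mu)%N -> (N <= m)%N ->
  (forall x (c : K), X x -> X (c *: x)) ->
  (forall phi : 'M[K]_(N.+1, m.+1), exists2 u : 'rV_N.+1, u != 0 & X (u *m phi)) ->
  exists (x : 'I_(nforms (m - N) mu) -> 'rV[K]_m.+1)
         (w : 'I_(nforms (m - N) mu) -> dhomog m.+1 K mu),
    (forall k, X (x k)) /\
    forall i j, (val (w j)).@[fun l => x i 0 l] = (i == j)%:R.
Proof.
move=> mu0 Nm cone big; have [[|k] [Y [hk hY]]] := noether_cone cone big.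
  by move: hk; rewrite addn0 leqNgt ltnS Nm.
pose E (x : {x | X x}) (h : dhomog k.+1 K mu) : K^o :=
  (val h).@[fun i => (sval x *m Y) 0 i].
have linE x : linear (E x).
  by move=> c p q; rewrite /E /= mevalD mevalZ.
pose El x : {linear _ -> K^o} := HB.pack (E x) (GRing.isLinear.Build _ _ _ _ (E x) (linE x)).
have [h h0|x [w hw]] := @interpolation _ _ _ El.
  apply: val_inj; apply: (hY mu) => //; first exact: dhomog_is_dhomog.
  by move=> x Xx; apply: (h0 (exist _ x Xx)).
have le : (nforms (m - N) mu <= \dim {:dhomog k.+1 K mu})%N.
  by rewrite dim_forms; apply: nforms_mono_vars; move: hk; rewrite addnS ltnS leq_subLR.
exists (fun i => sval (x (widen_ord le i))).
exists (fun j => homog_part mu (substM Y (val (w (widen_ord le j))))).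
split=> [i|i j]; first exact: svalP.
rewrite homog_partK; last by apply: dhomog_substM; apply: dhomog_is_dhomog.
by rewrite meval_substM; apply: (hw (widen_ord le i) (widen_ord le j)).
Qed.
End Points.

(** * Syzygies of the polar forms *)

Section Pigeonhole.
Variables (K : fieldType) (U W : vectType K) (P : finType) (n s : nat).
Variables (Phi : 'Hom(U, W)) (ev : P -> 'Hom(U, 'rV[K]_n)).

(** The kernel of Phi has codimension at most dim W, so its image under all the
    evaluations together has codimension at most dim W in a space of dimension
    n #|P|. If all the images had codimension more than s, it would be at
    least (s + 1) #|P|. *)
Lemma pigeonhole_evaluation :
  (forall val : P -> 'rV[K]_n, exists u, forall p, ev p u = val p) ->
  (\dim {:W} < s.+1 * #|P|)%N ->
  exists p, (n <= s + \dim (ev p @: lker Phi))%N.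
Proof.
move=> sur lt; apply: contrapT => hn.
have {}hn p : (s + \dim (ev p @: lker Phi) < n)%N.
  by rewrite ltnNge; apply/negP => h; apply: hn; exists p.
pose E (u : U) : {ffun P -> 'rV[K]_n} := [ffun p => ev p u].
have linE : linear E by move=> c u v; apply/ffunP => p; rewrite !ffunE linearP.
pose El : {linear U -> _} := HB.pack E (GRing.isLinear.Build _ _ _ _ E linE).
pose F := linfun El; have FE u : F u = E u by rewrite lfunE.
have dF : \dim (limg F) = (#|P| * n)%N.
  have -> : limg F = fullv.
    apply/eqP; rewrite eqEsubv subvf; apply/subvP => v _.
    have [u hu] := sur v; suff -> : v = F u by apply: memv_img; apply: memvf.
    by rewrite FE; apply/ffunP => p; rewrite ffunE hu.
  rewrite dimvf; transitivity (#|P| * (1 * n))%N; last by rewrite mul1n.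
  by [].
pose D p (v : 'rV[K]_n) : {ffun P -> 'rV[K]_n} := [ffun q => if q == p then v else 0].
have linD p : linear (D p).
  move=> c u v; apply/ffunP => q; rewrite !ffunE.
  by case: eqP; rewrite ?scaler0 ?addr0.
pose Dl p : {linear _ -> {ffun P -> 'rV[K]_n}} := HB.pack (D p) (GRing.isLinear.Build _ _ _ _ (D p) (linD p)).
have hZ : (\dim (F @: lker Phi) <= \sum_p \dim (ev p @: lker Phi))%N.
  apply: (@leq_trans (\dim (\sum_p (linfun (Dl p) @: (ev p @: lker Phi)))%VS)).
    apply/dimvS/subvP => v /memv_imgP[u uZ ->].
    have -> : F u = \sum_p Dl p (ev p u).
      rewrite FE; apply/ffunP => q; rewrite sum_ffunE ffunE (bigD1 q) //= ffunE eqxx.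
      by rewrite big1 ?addr0 // => p pq; rewrite ffunE eq_sym (negPf pq).
    apply: memv_suml => p _; apply: (subvP (sumv_sup p _ (subvv _))) => //.
    by rewrite -[Dl p _]lfunE; do 2!apply: memv_img.
  apply: leq_trans (dimv_leq_sum _ _ _) _; apply: leq_sum => p _.
  by rewrite -(limg_ker_dim (linfun (Dl p)) (_ @: _)%VS) leq_addl.
have dU := limg_ker_dim Phi fullv; rewrite capfv in dU.
have dW : (\dim (limg Phi) <= \dim {:W})%N by apply/dimvS/subvf.
have dF2 := limg_ker_dim F fullv; rewrite capfv dF in dF2.
have dZ := limg_ker_dim F (lker Phi).
have le : (\dim (lker Phi :&: lker F) <= \dim (lker F))%N by apply/dimvS/capvSr.
have sum_le : (\sum_p \dim (ev p @: lker Phi) + #|P| * s.+1 <= #|P| * n)%N.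
  rewrite -!sum_nat_const -big_split; apply: leq_sum => p _ /=.
  by rewrite addnS addnC.
move: lt sum_le hZ dU dW dF2 dZ le; rewrite mulnC.
move: (\dim _) (\dim _) (\dim _) (\dim _) (\dim _) (\dim _) (\dim _).
by move: (\sum_p _)%N (#|P| * s.+1)%N (#|P| * n)%N; clear; lia.
Qed.

(** The rows of q span a complement of the values of the kernel, and nu gives the
    coordinates of the standard basis along it. *)
Lemma pigeonhole_syzygies :
  (forall val : P -> 'rV[K]_n, exists u, forall p, ev p u = val p) ->
  (\dim {:W} < s.+1 * #|P|)%N ->
  exists p s', (s' <= s)%N /\ exists (c : 'I_n -> U) (nu : 'M[K]_(n, s')) (q : 'M[K]_(s', n)),
    (forall j, Phi (c j) = 0) /\
    forall j, delta_mx 0 j = ev p (c j) + row j nu *m q.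
Proof.
move=> sur lt; have [p hp] := pigeonhole_evaluation sur lt.
set N := (ev p @: lker Phi)%VS in hp.
exists p, (\dim N^C)%VS; split.
  rewrite dimv_compl leq_subLR addnC; apply: leq_trans hp.
  by rewrite dimvf /dim /= mul1n.
have h j : exists c : U * 'rV[K]_(\dim N^C)%VS, Phi c.1 = 0 /\
    delta_mx 0 j = ev p c.1 + c.2 *m \matrix_l (vbasis N^C)`_l.
  have : (delta_mx 0 j : 'rV[K]_n) \in (N + N^C)%VS by rewrite addv_complf memvf.
  case/memv_addP => v /memv_imgP[u uZ ->] [w wC ->].
  exists (u, \row_l coord (vbasis N^C) l w); split; first by apply/eqP; rewrite -memv_ker.
  congr (_ + _); rewrite {1}(coord_vbasis wC) mulmx_sum_row; apply: eq_bigr => l _.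
  by rewrite mxE rowK.
have /choice[c hc] := h; exists (fun j => (c j).1), (\matrix_j (c j).2), (\matrix_l (vbasis N^C)`_l).
by split=> j; have [? ?] := hc j; rewrite ?rowK.
Qed.
End Pigeonhole.

(** A bihomogeneous polynomial in t and x is represented by the matrix of its
    coefficients in products of basis elements. Evaluating the two sets of variables by
    arbitrary ring morphisms psi and psi' with values in a common ring covers both values
    at points and expansions at points. *)
Section Tensors.
Variables (K : fieldType) (n : nat).
Notation A := {mpoly K[n.+1]}.
Notation H s := (dhomog n.+1 K s).

Definition coords s (q : H s) : 'rV[K]_(\dim {:H s}) :=
  \row_i coord (vbasis {:H s}) i q.

Definition mulmat s D (g : A) : 'M[K]_(\dim {:H s}, \dim {:H (s + D)}) :=
  \matrix_i coords (mulH s (s + D) g (vbasis {:H s})`_i).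

Section Values.
Variables (B : comNzRingType) (iota : {rmorphism K -> B}).
Implicit Types (psi : {rmorphism A -> B}) (f g : A).

Definition basis_values psi s : 'cV[B]_(\dim {:H s}) :=
  \col_i psi (val (vbasis {:H s})`_i).

Lemma coords_values psi s (q : H s) :
  (forall c, psi c%:MP = iota c) ->
  map_mx iota (coords q) *m basis_values psi s = (psi (val q))%:M.
Proof.
move=> hpsi; apply/matrixP => i j; rewrite !ord1 [RHS]mxE mulr1n mxE.
rewrite {2}(coord_vbasis (memvf q)) linear_sum rmorph_sum; apply: eq_bigr => l _.
by rewrite !mxE linearZ /= -mul_mpolyC rmorphM /= hpsi.
Qed.

Lemma mulmat_values psi s D g : g \is D.-homog ->
  (forall c, psi c%:MP = iota c) ->
  map_mx iota (mulmat s D g) *m basis_values psi (s + D) = psi g *: basis_values psi s.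
Proof.
move=> hg hpsi; apply/row_matrixP => i.
rewrite row_mul -map_row rowK coords_values // val_mulH // rmorphM.
by apply/matrixP => a b; rewrite !ord1 !mxE.
Qed.

Definition tensor_value psi psi' s s' (C : 'M[K]_(\dim {:H s}, \dim {:H s'})) : B :=
  ((basis_values psi s)^T *m map_mx iota C *m basis_values psi' s') 0 0.

(** Multiplying by g(t) f(x) acts on coefficient matrices by the matrices of
    multiplication by g and by f. *)
Lemma tensor_value_mul psi psi' s s' D D' g f (C : 'M[K]_(\dim {:H s}, \dim {:H s'})) :
  (forall c, psi c%:MP = iota c) -> (forall c, psi' c%:MP = iota c) ->
  g \is D.-homog -> f \is D'.-homog ->
  tensor_value psi psi' ((mulmat s D g)^T *m C *m mulmat s' D' f) =
  psi g * psi' f * tensor_value psi psi' C.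
Proof.
move=> h h' hg hf; rewrite /tensor_value !map_mxM -!mulmxA (mulmat_values _ hf h').
rewrite !mulmxA -matrix.map_trmx -trmx_mul (mulmat_values _ hg h).
have -> : (psi g *: basis_values psi s)^T = psi g *: (basis_values psi s)^T.
  by apply/matrixP => i j; rewrite !mxE.
by rewrite -!scalemxAl -scalemxAr scalerA [LHS]mxE.
Qed.

Lemma tensor_value_pure psi psi' s s' (q : H s) (q' : H s') :
  (forall c, psi c%:MP = iota c) -> (forall c, psi' c%:MP = iota c) ->
  tensor_value psi psi' ((coords q)^T *m coords q') = psi (val q) * psi' (val q').
Proof.
move=> h h'; rewrite /tensor_value map_mxM -!mulmxA coords_values // mulmxA.
rewrite -matrix.map_trmx -trmx_mul coords_values // tr_scalar_mx -scalar_mxM.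
by rewrite mxE mulr1n.
Qed.

Fact tensor_value_additive psi psi' s s' : {morph @tensor_value psi psi' s s' : x y / x + y}.
Proof. by move=> x y; rewrite /tensor_value map_mxD mulmxDr mulmxDl mxE. Qed.

Lemma tensor_valueZ psi psi' s s' c C :
  @tensor_value psi psi' s s' (c *: C) = iota c * tensor_value psi psi' C.
Proof. by rewrite /tensor_value map_mxZ -scalemxAr -scalemxAl mxE. Qed.

Lemma tensor_value_sum psi psi' s s' (I : finType) F :
  @tensor_value psi psi' s s' (\sum_(i : I) F i) = \sum_i tensor_value psi psi' (F i).
Proof.
apply: (big_morph _ (@tensor_value_additive psi psi' s s')).
by rewrite /tensor_value map_mx0 mulmx0 mul0mx mxE.
Qed.
End Values.
End Tensors.

Section Syzygies.
Variables (K : fieldType) (n D a mu : nat) (f : {mpoly K[n.+1]}).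
Notation A := {mpoly K[n.+1]}.
Notation H s := (dhomog n.+1 K s).
Notation tensor := 'M[K]_(\dim {:H a}, \dim {:H mu}).

(** The coefficients of sum_j c_j G_j, of bidegree (a + 1, mu + D), where the
    summand X_k d_k d_j f of G_j is the product of a form in t and a form in x. *)
Definition contraction (c : {ffun 'I_n.+1 -> tensor}) :
    'M[K]_(\dim {:H (a + 1)}, \dim {:H (mu + D)}) :=
  \sum_j \sum_k (mulmat a 1 'X_k)^T *m c j *m mulmat mu D (f^`M(k)^`M(j)).

Lemma contraction_eq0 (B : comNzRingType) (iota : {rmorphism K -> B})
    (psi psi' : {rmorphism A -> B}) c : f \is D.+2.-homog ->
  (forall x, psi x%:MP = iota x) -> (forall x, psi' x%:MP = iota x) ->
  contraction c = 0 ->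
  \sum_j tensor_value iota psi psi' (c j) *
    (\sum_k psi 'X_k * psi' (f^`M(k)^`M(j))) = 0.
Proof.
move=> hf h h' c0; transitivity (tensor_value iota psi psi' (contraction c)).
  rewrite /contraction tensor_value_sum; apply: eq_bigr => j _.
  rewrite tensor_value_sum mulr_sumr; apply: eq_bigr => k _.
  rewrite tensor_value_mul //; first by rewrite mulrC.
    by rewrite dhomogX /= mdeg1.
  by do 2!apply: dhomog_mderiv.
by rewrite c0 /tensor_value map_mx0 mulmx0 mul0mx mxE.
Qed.

Fact contraction_linear : linear contraction.
Proof.
move=> x c c'; rewrite /contraction scaler_sumr -big_split; apply: eq_bigr => j _ /=.
rewrite scaler_sumr -big_split; apply: eq_bigr => k _ /=.
by rewrite !ffunE mulmxDr mulmxDl -scalemxAr -scalemxAl.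
Qed.
HB.instance Definition _ := GRing.isLinear.Build _ _ _ _ contraction contraction_linear.

Definition evaluation (t x : 'rV[K]_n.+1) (c : {ffun 'I_n.+1 -> tensor}) : 'rV[K]_n.+1 :=
  \row_j tensor_value idfun (meval (fun i => t 0 i)) (meval (fun i => x 0 i)) (c j).

Fact evaluation_linear t x : linear (evaluation t x).
Proof.
move=> y c c'; apply/rowP => j; rewrite !mxE !ffunE tensor_value_additive.
by rewrite tensor_valueZ.
Qed.
HB.instance Definition _ t x :=
  GRing.isLinear.Build _ _ _ _ (evaluation t x) (evaluation_linear t x).

End Syzygies.

Section PointOfFewSyzygies.
Variables (K : closedFieldType) (n D N a mu s : nat) (f : {mpoly K[n.+1]}).

(** For each of the points t interpolating forms of degree a, choose points x of the
    cone of zeros of G(t, -) interpolating many forms of degree mu. At the pairs (t, x)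
    arbitrary values can be prescribed, by products of dual forms. *)
Lemma syzygies_at_point :
  f \is D.+2.-homog -> (N <= n)%N -> (0 < a)%N -> (0 < mu)%N ->
  (forall (t : 'I_n.+1 -> K) (phi : 'M[K]_(N.+1, n.+1)), exists2 u : 'rV[K]_N.+1,
    u != 0 & forall j, (polar f t j).@[fun i => (u *m phi) 0 i] = 0) ->
  (nforms n (a + 1) * nforms n (mu + D) <
    s.+1 * (nforms n a * nforms (n - N) mu))%N ->
  exists t x : 'rV[K]_n.+1, (forall j, (polar f (t 0) j).@[fun i => x 0 i] = 0) /\
  exists s', (s' <= s)%N /\
  exists c (nu : 'M[K]_(n.+1, s')) (q : 'M[K]_(s', n.+1)),
    (forall i, @contraction K n D a mu f (c i) = 0) /\
    forall i, delta_mx 0 i = evaluation t x (c i) + row i nu *m q.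
Proof.
move=> hf Nn a0 mu0 meets lt.
(* The full space is a cone too, met by all subspaces of dimension 1. *)
have [|phi|t [tau [_ htau]]] := @dual_points K n 0 a (fun=> True) a0 (leq0n _).
- by [].
- by exists 1; rewrite ?oner_eq0.
rewrite subn0 in t tau htau.
have cone l (x : 'rV[K]_n.+1) (c : K) : (forall j, (polar f (t l 0) j).@[fun i => x 0 i] = 0) ->
    forall j, (polar f (t l 0) j).@[fun i => (c *: x) 0 i] = 0.
  move=> hx j; rewrite (@meval_homogZ _ _ _ D) ?hx ?mulr0 // polarE.
  by apply: rpred_sum => i _; apply: rpredZ; do 2!apply: dhomog_mderiv.
have /choice[x /choice[xi hx]] l := dual_points mu0 Nn (cone l) (meets (t l 0)).
pose P := ('I_(nforms n a) * 'I_(nforms (n - N) mu))%type.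
pose ev (p : P) := linfun (@evaluation K n a mu (t p.1) (x p.1 p.2)).
have sur (val : P -> 'rV[K]_n.+1) : exists c, forall p, ev p c = val p.
  exists [ffun j => \sum_p val p 0 j *: ((coords (tau p.1))^T *m coords (xi p.1 p.2))].
  move=> p; rewrite lfunE; apply/rowP => j; rewrite mxE ffunE tensor_value_sum.
  rewrite (bigD1 p) //= big1 ?addr0 => [|p' pp'];
    rewrite tensor_valueZ tensor_value_pure //=; try by move=> ?; rewrite mevalC.
    by rewrite (hx _).2 (htau p.1 p.1) !eqxx !mulr1.
  rewrite htau; case: eqP => [e|_]; last by rewrite mul0r mulr0.
  rewrite -e (hx p.1).2; case: eqP => [e'|_]; last by rewrite !mulr0.
  by case/eqP: pp'; case: (p') e e' => p1 p2 /= <- <-; case: (p).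
have [|p [s' [le [c [nu [q [hc hq]]]]]]] :=
    pigeonhole_syzygies (s := s) (linfun (@contraction K n D a mu f)) sur.
  by rewrite dimvf dim_matrix !dim_forms card_prod !card_ord.
exists (t p.1), (x p.1 p.2); split; first exact: (hx _).1.
exists s'; split=> //; exists c, nu, q; split=> i; first by rewrite -(hc i) lfunE.
by rewrite (hq i) lfunE.
Qed.
End PointOfFewSyzygies.

(** * Expansions at a point *)

Section Graded.
Variables (K : fieldType) (n : nat).
Notation A := {mpoly K[n]}.

(** The coefficient of e^i is a form of degree i; this is what homogeneity becomes when
    all the variables are multiplied by e. *)
Definition graded (q : {poly A}) := forall i, q`_i \is i.-homog.

Lemma gradedD p q : graded p -> graded q -> graded (p + q).
Proof. by move=> hp hq i; rewrite coefD; apply: rpredD. Qed.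

Lemma gradedM p q : graded p -> graded q -> graded (p * q).
Proof.
move=> hp hq i; rewrite coefM; apply: rpred_sum => j _.
have := dhomogM (hp j) (hq (i - j)%N); rewrite subnKC //.
exact: ltn_ord j.
Qed.

Lemma gradedC (c : K) : graded (c%:MP%:P).
Proof.
move=> i; rewrite coefC; case: eqP => [->|_]; last exact: rpred0.
by rewrite -[c]mulr1 mpolyCM mul_mpolyC; apply: rpredZ; rewrite mpolyC1 dhomog1.
Qed.

Lemma graded_sum (I : Type) (r : seq I) (P : pred I) F :
  (forall i, P i -> graded (F i)) -> graded (\sum_(i <- r | P i) F i).
Proof.
move=> h; apply: big_ind => //; last exact: gradedD.
by move=> i; rewrite coef0 rpred0.
Qed.

Lemma graded_prod (I : Type) (r : seq I) (P : pred I) F :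
  (forall i, P i -> graded (F i)) -> graded (\prod_(i <- r | P i) F i).
Proof.
move=> h; apply: big_ind => //; last exact: gradedM.
by rewrite -[1](_ : 1%:MP%:P = _) //; apply: gradedC.
Qed.

(** The polynomial v + e X substituted in p, as a polynomial in e. *)
Definition expand (v : 'I_n -> K) : A -> {poly A} :=
  mmap (polyC \o @mpolyC n K) (fun i => (v i)%:MP%:P + 'X_i *: 'X).

HB.instance Definition _ v := GRing.RMorphism.copy (expand v)
  (mmap (polyC \o @mpolyC n K) (fun i => (v i)%:MP%:P + 'X_i *: 'X)).

Lemma expandC v c : expand v c%:MP = c%:MP%:P.
Proof. by rewrite /expand mmapC. Qed.

Lemma expandX v i : expand v 'X_i = (v i)%:MP%:P + 'X_i *: 'X.
Proof. by rewrite /expand mmapX mmap1U. Qed.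

Lemma expand_graded v p : graded (expand v p).
Proof.
apply: graded_sum => m _; apply: gradedM; first exact: gradedC.
apply: graded_prod => i _; rewrite -[m i]card_ord -prodr_const.
apply: graded_prod => _ _.
apply: gradedD; first exact: gradedC.
move=> l; rewrite coefZ coefX; case: eqP => [->|_]; last by rewrite mulr0 rpred0.
by rewrite mulr1 dhomogX /= mdeg1.
Qed.

Lemma coef0_expand v p : (expand v p)`_0 = (p.@[v])%:MP.
Proof.
rewrite /expand /meval /mmap coef_sum [RHS]raddf_sum /=; apply: eq_bigr => m _.
rewrite coefCM mpolyCM; congr (_ * _).
rewrite -horner_coef0 /mmap1 horner_prod rmorph_prod; apply: eq_bigr => i _.
by rewrite horner_exp hornerD hornerC hornerZ hornerX mulr0 addr0 rmorphXn.
Qed.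

(** The bound on the size is what makes the top coefficients multiplicative. *)
Definition top_coef e (q : {poly A}) p := (size q <= e.+1)%N /\ q`_e = p.

Lemma top_coefM e e' q q' p p' :
  top_coef e q p -> top_coef e' q' p' -> top_coef (e + e') (q * q') (p * p').
Proof.
move=> [s <-] [s' <-]; split.
  by apply: leq_trans (size_polyMleq _ _) _; rewrite -subn1 leq_subLR;
    apply: leq_trans (leq_add s s') _; rewrite !addSn !addnS.
have le : (e < (e + e').+1)%N by lia.
rewrite coefM (bigD1 (Ordinal le)) //= addKn big1 ?addr0 // => i /eqP ne.
have [lt|gt|eq] := ltngtP i e; last by case: ne; apply: val_inj.
  by rewrite [q'`__]nth_default ?mulr0 //; apply: leq_trans s' _; lia.
by rewrite [q`__]nth_default ?mul0r //; apply: leq_trans s gt.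
Qed.

(** The top order term does not depend on the point v. *)
Lemma expand_homog v e p : p \is e.-homog -> top_coef e (expand v p) p.
Proof.
move=> hp.
have hX m : top_coef (mdeg m) (expand v 'X_[m]) 'X_[m].
  rewrite mpolyXE_id mdegE rmorph_prod /=.
  apply: (big_ind3 (fun e q p => top_coef e q p)); first by split; rewrite ?size_poly1 ?coef1.
    by move=> *; apply: top_coefM.
  move=> i _; rewrite rmorphXn /=; elim: (m i) => [|k IH].
    by rewrite !expr0; split; rewrite ?size_poly1 ?coef1.
  rewrite !exprS -add1n; apply: top_coefM => //; rewrite expandX; split.
    apply: leq_trans (size_polyD _ _) _; rewrite geq_max.
    by rewrite (leq_trans (size_polyC_leq1 _)) // (leq_trans (size_scale_leq _ _)) ?size_polyX.
  by rewrite coefD coefC coefZ coefX /= add0r mulr1.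
have hs : expand v p = \sum_(m <- msupp p) (p@_m)%:MP%:P * expand v 'X_[m].
  rewrite {1}(mpolyE p) rmorph_sum; apply: eq_bigr => m _.
  by rewrite -mul_mpolyC rmorphM /= expandC.
split.
  rewrite hs; apply: leq_trans (size_sum _ _ _) _; apply/bigmax_leqP_seq => m mp _.
  rewrite mul_polyC; apply: leq_trans (size_scale_leq _ _) _.
  by have [h _] := hX m; rewrite (dhomog_mf hp mp) in h.
rewrite hs coef_sum [RHS]mpolyE; apply: eq_big_seq => m mp.
rewrite coefCM mul_mpolyC; congr (_ *: _).
by have [_] := hX m; rewrite (dhomog_mf hp mp).
Qed.
End Graded.

Section Propagation.
Variables (K : fieldType) (n s M : nat).
Notation A := {mpoly K[n]}.
Variable b : 'I_s -> nat -> A.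

(** Combinations of the b_(l, m') with 1 <= m' <= m and coefficients that are forms of the
    complementary degree. The fixed bound M on the range of summation only avoids
    having to change it when m varies. *)
Definition generated m (p : A) := exists delta : 'I_s -> nat -> A,
  (forall l m', [/\ (0 < m')%N, (m' <= m)%N & delta l m' \is (m - m').-homog] \/
                delta l m' = 0) /\
  p = \sum_l \sum_(m' < M) delta l m' * b l m'.

Lemma generated0 m : generated m 0.
Proof.
exists (fun _ _ => 0); split=> [l m'|]; first by right.
by rewrite big1 // => l _; rewrite big1 // => m' _; rewrite mul0r.
Qed.

Lemma generatedD m p q : generated m p -> generated m q -> generated m (p + q).
Proof.
move=> [x [hx ->]] [y [hy ->]]; exists (fun l m' => x l m' + y l m'); split.
  move=> l m'; have [[m0 le h]|->] := hx l m'; last by rewrite add0r; apply: hy.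
  have [[_ _ h']|->] := hy l m'; left; split=> //; last by rewrite addr0.
  exact: rpredD.
rewrite -big_split; apply: eq_bigr => l _; rewrite -big_split.
by apply: eq_bigr => m' _; rewrite mulrDl.
Qed.

Lemma generatedM m k c p : c \is k.-homog -> generated m p -> generated (k + m) (c * p).
Proof.
move=> hc [x [hx ->]]; exists (fun l m' => c * x l m'); split.
  move=> l m'; have [[m0 le h]|->] := hx l m'; last by right; rewrite mulr0.
  left; split=> //; first exact: leq_trans le (leq_addl _ _).
  by rewrite -addnBA //; apply: dhomogM.
rewrite mulr_sumr; apply: eq_bigr => l _; rewrite mulr_sumr.
by apply: eq_bigr => m' _; rewrite mulrA.
Qed.

Lemma generated_sum m (I : Type) (r : seq I) (P : pred I) F :
  (forall i, P i -> generated m (F i)) -> generated m (\sum_(i <- r | P i) F i).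
Proof.
by move=> h; apply: big_ind => //; [exact: generated0 | exact: generatedD].
Qed.

Lemma generated_base l m : (0 < m)%N -> (m < M)%N -> generated m (b l m).
Proof.
move=> m0 mM; exists (fun l' m' => ((l' == l) && (m' == m))%:R); split=> [l' m'|].
  case: andP => [[_ /eqP ->]|_]; last by right.
  by left; rewrite leqnn subnn dhomog1.
rewrite (bigD1 l) //= (bigD1 (Ordinal mM)) //= !eqxx mul1r !big1 ?addr0 //.
  by move=> l' /negPf ne; rewrite big1 // => m' _; rewrite ne mul0r.
by move=> m' /negPf ne; rewrite -val_eqE /= in ne; rewrite ne andbF mul0r.
Qed.

(** The i-th relation in degree m reads: g_(i, m) minus a combination of the b_(l, m) is
    minus the sum of the gam_(i, j, k) g_(j, m - k) with k > 0, to which induction applies. *)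
Lemma propagation p (g : 'I_p -> nat -> A) (gam : 'I_p -> 'I_p -> nat -> A)
    (nu : 'M[K]_(p, s)) (q : 'M[K]_(s, p)) :
  (forall j, g j 0%N = 0) ->
  (forall l m, b l m = \sum_j q l j *: g j m) ->
  (forall i j m, gam i j m \is m.-homog) ->
  (forall i j, gam i j 0%N = ((i == j)%:R - (nu *m q) i j)%:MP) ->
  (forall i m, \sum_j \sum_(k < m.+1) gam i j k * g j (m - k)%N = 0) ->
  forall m i, (m < M)%N -> generated m (g i m).
Proof.
move=> g0 bE hgam gam0 rel; elim/ltn_ind => m IH i mM.
have [->|m0] := posnP m; first by rewrite g0; apply: generated0.
have := rel i m; under eq_bigr => j _ do rewrite big_ord_recl subn0 /= gam0 mul_mpolyC.
rewrite big_split /= => /eqP; rewrite addr_eq0 => /eqP e.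
have {e} -> : g i m = \sum_l nu i l *: b l m -
    \sum_j \sum_(k < m) gam i j (bump 0 k) * g j (m - bump 0 k)%N.
  rewrite -e; under [X in _ = _ + X]eq_bigr => j _ do rewrite scalerBl.
  rewrite sumrB (bigD1 i) //= eqxx scale1r [X in _ + X - _]big1 ?addr0.
    rewrite addrC -addrA [X in _ + X]addrC -[LHS]addr0; congr (_ + _).
    apply/esym/eqP; rewrite subr_eq0; apply/eqP.
    under [LHS]eq_bigr => l _ do rewrite bE scaler_sumr.
    rewrite exchange_big; apply: eq_bigr => j _ /=.
    by rewrite mxE scaler_suml; apply: eq_bigr => l _; rewrite scalerA.
  by move=> j /negPf ne; rewrite eq_sym ne scale0r.
apply: generatedD.
  apply: generated_sum => l _; rewrite -mul_mpolyC -[m in generated m _]add0n.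
  apply: generatedM; last exact: generated_base.
  by rewrite -[nu i l]mulr1 mpolyCM mul_mpolyC; apply: rpredZ; rewrite mpolyC1 dhomog1.
rewrite -sumrN; apply: generated_sum => j _; rewrite -sumrN.
apply: generated_sum => k _; rewrite -mulNr /bump add1n.
rewrite -[m in generated m _](subnKC (ltn_ord k)); apply: generatedM.
  by rewrite rpredN; apply: hgam.
by apply: IH; [rewrite ltn_subrL m0 | apply: leq_ltn_trans (leq_subr _ _) mM].
Qed.
End Propagation.

Lemma euler (K : fieldType) n (p : {mpoly K[n]}) e : p \is e.-homog ->
  \sum_i 'X_i * p^`M(i) = e%:R *: p.
Proof.
move=> hp; rewrite [in RHS](mpolyE p) scaler_sumr.
under eq_bigr => i _ do rewrite [X in X^`M(_)](mpolyE p) linear_sum mulr_sumr.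
rewrite exchange_big; apply: eq_big_seq => m mp /=.
have <- : mdeg m = e := dhomog_mf hp mp.
rewrite scalerA mulrC -scalerA; rewrite mdegE natr_sum scaler_suml scaler_sumr.
apply: eq_bigr => i _; rewrite linearZ -scalerAr /= mderivX -scalerAr.
congr (_ *: _); have [->|m0] := posnP (m i); first by rewrite !scale0r.
by congr (_ *: _); rewrite -mpolyXD addmC submK // lep1mP -lt0n.
Qed.

Lemma small_rank_sum (K : fieldType) n (I : finType) (L R : I -> {mpoly K[n]}) r :
  (#|I| <= r)%N -> (forall i, homog_pos (L i) /\ homog_pos (R i)) ->
  small_rank (\sum_i L i * R i) r.
Proof.
move=> le h; exists #|I| => //; exists (L \o enum_val), (R \o enum_val).
by split=> [i|]; [apply: h | rewrite /= (reindex _ (onW_bij _ (enum_val_bij I)))].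
Qed.

(** * From syzygies to a decomposition *)

Section RankBound.
Variable K : fieldType.

Lemma coef0_tensor_value n a mu (t x : 'I_n.+1 -> K) C :
  (tensor_value (polyC \o @mpolyC n.+1 K : {rmorphism _ -> _}) (expand t) (expand x) C)`_0 =
  (@tensor_value K n K idfun (meval t) (meval x) a mu C)%:MP.
Proof.
rewrite /tensor_value !mxE coef_sum rmorph_sum; apply: eq_bigr => i _ /=.
rewrite !mxE coef0M rmorphM /= coef0_expand; congr (_ * _).
rewrite coef_sum rmorph_sum; apply: eq_bigr => j _ /=.
by rewrite !mxE coef0M coef0_expand coefC eqxx mpolyCM.
Qed.

Lemma tensor_value_graded n a mu (t x : 'I_n.+1 -> K) C :
  graded (@tensor_value K n _ (polyC \o @mpolyC n.+1 K : {rmorphism _ -> _})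
    (expand t) (expand x) a mu C).
Proof.
rewrite /tensor_value !mxE; apply: graded_sum => i _; apply: gradedM; last first.
  by rewrite mxE; apply: expand_graded.
rewrite mxE; apply: graded_sum => j _; apply: gradedM; rewrite !mxE.
  exact: expand_graded.
exact: gradedC.
Qed.

(** The polar form G_j expanded at (t, x) along the diagonal direction (X, X). *)
Definition polar_expansion n (f : {mpoly K[n]}) t x j : {poly {mpoly K[n]}} :=
  \sum_k expand t 'X_k * expand x (f^`M(k)^`M(j)).

Lemma polar_expansion_graded n (f : {mpoly K[n]}) t x j : graded (polar_expansion f t x j).
Proof. by apply: graded_sum => k _; apply: gradedM; apply: expand_graded. Qed.

Lemma coef0_polar_expansion n (f : {mpoly K[n]}) t x j :
  (polar_expansion f t x j)`_0 = ((polar f t j).@[x])%:MP.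
Proof.
rewrite polarE (raddf_sum (meval x)) (raddf_sum (@mpolyC n K)) coef_sum.
apply: eq_bigr => k _.
rewrite coef0M.
have h1 := coef0_expand t 'X_k.
have h2 := coef0_expand x (f^`M(k)^`M(j)).
apply: (etrans (congr2 *%R h1 h2)).
rewrite mevalXU.
rewrite -mpolyCM.
by congr (_%:MP); rewrite /= mevalZ.
Qed.

Lemma top_polar_expansion n D (f : {mpoly K[n]}) t x j : f \is D.+2.-homog ->
  (polar_expansion f t x j)`_D.+1 = \sum_k 'X_k * f^`M(k)^`M(j).
Proof.
move=> hf; rewrite coef_sum; apply: eq_bigr => k _; rewrite -add1n.
have hX : ('X_k : {mpoly K[n]}) \is 1.-homog by rewrite dhomogX /= mdeg1.
have hff : f^`M(k)^`M(j) \is D.-homog by do 2!apply: dhomog_mderiv.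
by have [_] := top_coefM (expand_homog t hX) (expand_homog x hff).
Qed.

(** Euler's identity, applied to the gradient and then to f. *)
Lemma sum_polar_expansion n D (f : {mpoly K[n]}) t x : f \is D.+2.-homog ->
  \sum_j 'X_j * (polar_expansion f t x j)`_D.+1 = (D.+2 * D.+1)%:R *: f.
Proof.
move=> hf; under eq_bigr => j _ do rewrite (top_polar_expansion _ _ _ hf) mulr_sumr.
rewrite exchange_big mulnC natrM -scalerA -(euler hf) scaler_sumr.
apply: eq_bigr => k _ /=; rewrite scalerAr -(euler (dhomog_mderiv k hf)) mulr_sumr.
by apply: eq_bigr => j _; rewrite mulrCA.
Qed.

(** By [propagation] the coefficients of order D + 1 of the polar forms are combinations
    of the s (D + 1) forms b_(l, m), with 1 <= m <= D + 1. After multiplication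
    by the variables, all cofactors have positive degree. *)
Lemma rank_of_syzygies n D a mu s (f : {mpoly K[n.+1]}) (t x : 'rV[K]_n.+1) c
    (nu : 'M[K]_(n.+1, s)) (q : 'M[K]_(s, n.+1)) :
  f \is D.+2.-homog -> (D.+2 * D.+1)%:R != 0 :> K ->
  (forall j, (polar f (t 0) j).@[fun i => x 0 i] = 0) ->
  (forall i, @contraction K n D a mu f (c i) = 0) ->
  (forall i, delta_mx 0 i = evaluation t x (c i) + row i nu *m q) ->
  small_rank f (s * D.+1).
Proof.
move=> hf nz hx hc hq.
pose iota : {rmorphism K -> {poly {mpoly K[n.+1]}}} := polyC \o @mpolyC n.+1 K.
pose ghat := polar_expansion f (t 0) (x 0).
pose gam i j := tensor_value iota (expand (t 0)) (expand (x 0)) (c i j).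
pose b l m := \sum_j q l j *: (ghat j)`_m.
have hb l m : b l m \is m.-homog by apply: rpred_sum => j _; apply: rpredZ; apply: polar_expansion_graded.
have gen j : generated D.+2 b D.+1 ((ghat j)`_D.+1).
  apply: (@propagation _ _ _ D.+2 b _ (fun j m => (ghat j)`_m) (fun i j m => (gam i j)`_m) nu q) => //.
  - by move=> {}j; rewrite coef0_polar_expansion hx mpolyC0.
  - by move=> i {}j m; apply: tensor_value_graded.
  - move=> i {}j; rewrite coef0_tensor_value; congr (_%:MP).
    have /rowP/(_ j) := hq i; rewrite !mxE eqxx /= eq_sym => ->.
    rewrite (eq_bigr (fun l => nu i l * q l j)) ?addrK // => l _.
    by rewrite mxE.
  - move=> i m; rewrite -[RHS](coef0 _ m).
    rewrite -(contraction_eq0 (psi := expand (t 0)) (psi' := expand (x 0)) (iota := iota) hf _ _ (hc i)).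
    + by rewrite coef_sum; apply: eq_bigr => {}j _; rewrite coefM.
    + by move=> y; rewrite /= expandC.
    + by move=> y; rewrite /= expandC.
have /choice[delta hdelta] := gen.
pose d1 l m' := ((D.+2 * D.+1)%:R)^-1 *: \sum_j 'X_j * delta j l m'.
have hd1 l (m' : 'I_D.+1) : homog_pos (d1 l m'.+1).
  exists (D.+1 - m')%N; first by rewrite subn_gt0.
  apply: rpredZ; apply: rpred_sum => j _.
  have [[_ _ h]|->] := (hdelta j).1 l m'.+1; last by rewrite mulr0 rpred0.
  have -> : (D.+1 - m' = 1 + (D.+1 - m'.+1))%N by have := ltn_ord m'; lia.
  by apply: dhomogM => //; rewrite dhomogX /= mdeg1.
have -> : f = \sum_(lm : 'I_s * 'I_D.+1) d1 lm.1 lm.2.+1 * b lm.1 lm.2.+1.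
  have -> : f = ((D.+2 * D.+1)%:R)^-1 *: \sum_j 'X_j * (ghat j)`_D.+1.
    by rewrite (sum_polar_expansion _ _ hf) scalerA mulVf // scale1r.
  rewrite -(pair_big_dep xpredT (fun _ _ => true) (fun l (m : 'I_D.+1) => d1 l m.+1 * b l m.+1)) /=.
  under eq_bigr => j _ do rewrite (hdelta j).2 mulr_sumr.
  rewrite exchange_big scaler_sumr; apply: eq_bigr => l _ /=.
  under eq_bigr => j _ do rewrite big_ord_recl /= mulrDr.
  rewrite big_split /= big1 ?add0r => [|j _]; last first.
    have [[]|->] := (hdelta j).1 l 0%N; first by rewrite ltnn.
    by rewrite mul0r mulr0.
  under eq_bigr => j _ do rewrite mulr_sumr.
  rewrite exchange_big scaler_sumr; apply: eq_bigr => m _ /=.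
  rewrite /d1 -scalerAl mulr_suml; congr (_ *: _).
  by apply: eq_bigr => j _; rewrite mulrA.
apply: small_rank_sum; first by rewrite card_prod !card_ord.
by move=> [l m]; split=> //=; exists m.+1.
Qed.
End RankBound.

(** * The bound over an algebraically closed field *)

Section RankBoundFromDerivatives.
Variable K : closedFieldType.

Definition cone_codim r D := let L := (8 * r * 2 ^ D)%N in (L * L ^ D)%N.
(** The first summand covers the case of at most 2 N variables; the factor
    2 * 2 ^ D * 3 ^ N is the number s of exceptional directions in [syzygy_count]. *)
Definition rank_bound r D :=
  let N := cone_codim r D in (2 * N + 2 * 2 ^ D * 3 ^ N * D.+1)%N.

(** Removing one of j + 1 variables divides the number of forms of degree mu by
    (mu + j) / j, which is at most 3 as long as mu <= 2 j. *)
Lemma nforms_drop_vars n N mu : (2 * N <= n)%N -> (mu <= n)%N ->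
  (nforms n mu <= 3 ^ N * nforms (n - N) mu)%N.
Proof.
move=> le hmu; suff h k : (k <= N)%N -> (nforms n mu <= 3 ^ k * nforms (n - k) mu)%N.
  exact: h.
elim: k => [|k IH] lt; first by rewrite subn0 mul1n.
apply: leq_trans (IH (ltnW lt)) _; rewrite expnSr -mulnA leq_mul2l; apply/orP; right.
have hj : (n <= 2 * (n - k.+1).+1)%N by lia.
have -> : (n - k = (n - k.+1).+1)%N by lia.
move: (n - k.+1)%N hj => j hj; rewrite -(leq_pmul2l (ltn0Sn j)).
rewrite /nforms addnS -mul_bin_diag mulnCA mulnA leq_mul2r mulnC.
by apply/orP; right; move: hj hmu; clear; lia.
Qed.

(** With all degrees equal to n, raising a degree by one at most doubles the number of
    forms, and removing N variables divides it by at most 3 ^ N. *)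
Lemma syzygy_count n N D : (0 < n)%N -> (2 * N <= n)%N ->
  (nforms n (n + 1) * nforms n (n + D) <
   (2 * 2 ^ D * 3 ^ N).+1 * (nforms n n * nforms (n - N) n))%N.
Proof.
move=> n0 le; have h k : (nforms n (n + k) <= 2 ^ k * nforms n n)%N.
  by apply: (@nforms_le_exp _ _ _ 1); rewrite ?mul1n.
have h3 := nforms_drop_vars le (leqnn n).
apply: (@leq_ltn_trans ((2 * nforms n n) * (2 ^ D * (3 ^ N * nforms (n - N) n)))).
  apply: leq_mul; first exact: (h 1%N).
  by apply: leq_trans (h D) _; rewrite leq_mul2l h3 orbT.
have -> : (2 * nforms n n * (2 ^ D * (3 ^ N * nforms (n - N) n)) =
  2 * 2 ^ D * 3 ^ N * (nforms n n * nforms (n - N) n))%N.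
  move: (nforms n n) (nforms (n - N) n) (2 ^ D)%N (3 ^ N)%N => x y p q.
  by ring.
by rewrite ltn_mul2r ltnSn andbT muln_gt0 !nforms_gt0.
Qed.

Lemma small_rank_le m (f : {mpoly K[m]}) r r' : (r <= r')%N ->
  small_rank f r -> small_rank f r'.
Proof. by move=> le [s hs h]; exists s => //; apply: leq_trans le. Qed.

(** By Euler's identity f is a combination of its partial derivatives with linear
    coefficients. *)
Lemma rank_le_nvars m (f : {mpoly K[m]}) d : (1 < d)%N -> d%:R != 0 :> K ->
  f \is d.-homog -> small_rank f m.
Proof.
case: d => [|d]//; rewrite ltnS => d0 nz hf.
have -> : f = \sum_i (d.+1%:R^-1 *: 'X_i) * f^`M(i).
  under eq_bigr => i _ do rewrite -scalerAl.
  by rewrite -scaler_sumr (euler hf) scalerA mulVf // scale1r.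
apply: small_rank_sum; first by rewrite card_ord.
move=> i; split; last by exists d => //; apply: dhomog_mderiv.
by exists 1%N => //; apply: rpredZ; rewrite dhomogX /= mdeg1.
Qed.

(** Directions on a grid suffice. This is what allows to bound ranks over K when the
    hypothesis is known only for directions defined over a subfield. *)
Theorem rank_from_derivatives m D r (f : {mpoly K[m]}) (S : seq K) :
  (0 < D)%N -> (0 < r)%N -> (D.+2 * D.+1)%:R != 0 :> K ->
  uniq S -> (3 < size S)%N -> f \is D.+2.-homog ->
  (forall a : 'I_m -> K, (forall i, a i \in S) -> small_rank (\sum_i a i *: f^`M(i)) r) ->
  small_rank f (rank_bound r D).
Proof.
move=> D0 r0 nz uS S3 hf hS; rewrite /rank_bound.
have N0 : (0 < cone_codim r D)%N by rewrite !muln_gt0 !expn_gt0 !muln_gt0 r0 !expn_gt0.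
have meets : forall t (phi : 'M[K]_((cone_codim r D).+1, m)), exists2 u : 'rV[K]__,
    u != 0 & forall j, (polar f t j).@[fun i => (u *m phi) 0 i] = 0.
  exact: meets_small_subspaces D0 r0 uS S3 hf hS.
move: (cone_codim r D) N0 meets => N N0 meets {hS}.
have [le|] := leqP m (2 * N).
  apply: (small_rank_le (r := m)); first exact: leq_trans le (leq_addr _ _).
  apply: (rank_le_nvars (d := D.+2)) => //.
  by apply: contra_neq nz => e; rewrite natrM e mul0r.
case: m f hf meets => // n f hf meets; rewrite ltnS => le.
have n0 : (0 < n)%N by apply: leq_trans le; rewrite muln_gt0.
have Nn : (N <= n)%N by apply: leq_trans le; rewrite leq_pmull.
have [t [x [hx [s' [ls [c [nu [q [hc hq]]]]]]]]] :=
  syzygies_at_point hf Nn n0 n0 meets (syzygy_count D n0 le).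
apply: small_rank_le (rank_of_syzygies hf nz hx hc hq).
by apply: leq_trans (leq_addl _ _); rewrite leq_mul2r ls orbT.
Qed.
End RankBoundFromDerivatives.

(** * Leading forms of differences *)

Section Shift.
Variables (k : fieldType) (n : nat) (v : 'I_n -> k).
Notation A := {mpoly k[n]}.

Definition shift (p : A) : A := p \mPo [tuple 'X_i + (v i)%:MP | i < n].
HB.instance Definition _ := GRing.RMorphism.copy shift
  (comp_mpoly [tuple 'X_i + (v i)%:MP | i < n]).
HB.instance Definition _ := GRing.Linear.copy shift
  (comp_mpoly [tuple 'X_i + (v i)%:MP | i < n]).

Definition dirderiv (p : A) : A := \sum_i v i *: p^`M(i).
Fact dirderiv_linear : linear dirderiv.
Proof.
move=> c p q; rewrite /dirderiv scaler_sumr -big_split; apply: eq_bigr => i _ /=.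
by rewrite linearP scalerDr !scalerA mulrC.
Qed.
HB.instance Definition _ := GRing.isLinear.Build _ _ _ _ dirderiv dirderiv_linear.

Lemma msize_leP (p : A) s :
  reflect (forall m, p@_m != 0 -> (mdeg m < s)%N) (msize p <= s)%N.
Proof.
apply: (iffP idP) => [h m|h].
  by rewrite -mcoeff_msupp => /msize_mdeg_lt lt; apply: leq_trans lt h.
by rewrite msizeE; apply/bigmax_leqP_seq => m mp _; apply: h; rewrite -mcoeff_msupp.
Qed.

Lemma msize_mderiv (p : A) i : (msize p^`M(i) <= (msize p).-1)%N.
Proof.
apply/msize_leP => m; rewrite mcoeff_mderiv => h.
have : (m + U_(i))%MM \in msupp p.
  by rewrite mcoeff_msupp; apply: contra_neq h => ->; rewrite mul0rn.
by move/msize_mdeg_lt; rewrite mdegD mdeg1 addn1; case: (msize p).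
Qed.

Lemma msize_le_sum (I : Type) (r : seq I) (P : pred I) (F : I -> A) s :
  (forall i, P i -> (msize (F i) <= s)%N) -> (msize (\sum_(i <- r | P i) F i) <= s)%N.
Proof.
move=> h; apply: (big_ind (fun p => (msize p <= s)%N)) => //; first by rewrite msize0.
move=> p q hp hq; apply: leq_trans (msizeD_le _ _) _; by rewrite geq_max hp.
Qed.

Lemma msize_dirderiv (p : A) : (msize (dirderiv p) <= (msize p).-1)%N.
Proof.
apply: msize_le_sum => i _; apply: leq_trans (msizeZ_le _ _) _; exact: msize_mderiv.
Qed.

Lemma msizeMXU i (p : A) : (msize ('X_i * p) <= (msize p).+1)%N.
Proof.
have [->|p0] := eqVneq p 0; first by rewrite mulr0 msize0.
by rewrite msizeM -?msize_poly_eq0 ?msizeX ?mdeg1 // msize_poly_eq0.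
Qed.

(** The Taylor expansion to first order, by induction on the monomial: if E is the
    remainder of p, then the one of X_i p is X_i E + v_i (E + dirderiv p). *)
Lemma shift_monomial e m : mdeg m = e ->
  (msize (shift 'X_[m] - 'X_[m] - dirderiv 'X_[m]) <= e.-1)%N.
Proof.
elim: e m => [|e IH] m.
  move/eqP; rewrite mdeg_eq0 => /eqP ->; rewrite mpolyX0 rmorph1 subrr sub0r.
  rewrite /dirderiv big1 ?oppr0 ?msize0 // => i _.
  by rewrite -mpolyC1 mderivC scaler0.
move=> me; have [i mi] : exists i, (0 < m i)%N.
  apply: contrapT => h; have : mdeg m = 0%N; last by rewrite me.
  rewrite mdegE big1 // => i _; apply/eqP; rewrite -leqn0 leqNgt.
  by apply/negP => hi; apply: h; exists i.
have em : m = (U_(i) + (m - U_(i)))%MM by rewrite addmC submK // lep1mP -lt0n.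
move: (m - U_(i))%MM em => m' em; subst m.
have {}me : mdeg m' = e by move: me; rewrite mdegD mdeg1 add1n => -[].
have := IH m' me; set p := 'X_[m']; set E := (X in msize X) => hE.
have -> : shift 'X_[(U_(i) + m')] - 'X_[(U_(i) + m')] - dirderiv 'X_[(U_(i) + m')] =
    'X_i * E + v i *: (E + dirderiv p).
  have -> : dirderiv 'X_[(U_(i) + m')] = v i *: p + 'X_i * dirderiv p.
    rewrite mpolyXD /dirderiv mulr_sumr -/p.
    under eq_bigr => j _ do rewrite mderivM scalerDr mderivX mnm1E.
    rewrite big_split /= (bigD1 i) //= eqxx scale1r -{1}[U_(i)%MM]add0m addmK mpolyX0 mul1r.
    rewrite big1 ?addr0 => [|j /negPf ne]; last first.
      by rewrite eq_sym ne scale0r mul0r scaler0.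
    by congr (_ + _); apply: eq_bigr => j _; rewrite scalerAr.
  rewrite mpolyXD rmorphM /= -/p.
  have -> : shift 'X_i = 'X_i + (v i)%:MP.
    by rewrite /shift comp_mpolyXU -tnth_nth tnth_mktuple.
  by rewrite -!mul_mpolyC /E; ring.
have hD : (msize (dirderiv p) <= e)%N.
  by apply: leq_trans (msize_dirderiv _) _; rewrite msizeX me.
have hE' : (msize E <= e)%N by apply: leq_trans hE (leq_pred _).
apply: leq_trans (msizeD_le _ _) _; rewrite geq_max; apply/andP; split; last first.
  apply: leq_trans (msizeZ_le _ _) _; apply: leq_trans (msizeD_le _ _) _.
  by rewrite geq_max hE' hD.
have [e0|e0] := posnP e; last first.
  by apply: leq_trans (msizeMXU _ _) _; rewrite -(prednK e0) ltnS.
by move: hE'; rewrite e0 leqn0 msize_poly_eq0 => /eqP ->; rewrite mulr0 msize0.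
Qed.

Lemma shift_sub_dirderiv p : (msize (shift p - p - dirderiv p) <= (msize p).-2)%N.
Proof.
have -> : shift p - p - dirderiv p =
    \sum_(m <- msupp p) p@_m *: (shift 'X_[m] - 'X_[m] - dirderiv 'X_[m]).
  rewrite {1 2 3}(mpolyE p) (linear_sum shift) (linear_sum dirderiv) -!sumrB; apply: eq_bigr => m _.
  by rewrite !scalerBr -!linearZ.
rewrite big_seq; apply: msize_le_sum => m mp.
apply: leq_trans (msizeZ_le _ _) _; apply: leq_trans (shift_monomial (erefl _)) _.
by have := msize_mdeg_lt mp; move: (mdeg m) (msize p) => x y; clear; lia.
Qed.
End Shift.

Lemma top_partD (k : fieldType) n (g low : {mpoly k[n]}) e :
  g \is e.-homog -> g != 0 -> (msize low <= e)%N ->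
  mdegree (g + low) = e /\ top_part (g + low) = g.
Proof.
move=> hg g0 hlow.
have low0 : pihomog mdeg e low = 0.
  rewrite pihomogE big_seq_cond big1 // => m /andP[mp /eqP me].
  by have := msize_mdeg_lt mp; rewrite me ltnNge hlow.
have hs : msize (g + low) = e.+1.
  apply/eqP; rewrite eqn_leq; apply/andP; split.
    apply: leq_trans (msizeD_le _ _) _; rewrite geq_max msize_homog //=.
    exact: leq_trans hlow _.
  rewrite ltnNge; apply/negP => /msize_leP le; case/eqP: g0.
  apply/mpolyP => m; rewrite mcoeff0; apply/eqP/negPn/negP => gm.
  have me : mdeg m = e by apply: (dhomog_mf hg); rewrite mcoeff_msupp.
  have lowm : low@_m = 0.
    by apply/eqP/negPn/negP => /(msize_leP _ _ hlow); rewrite me ltnn.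
  by have := le m; rewrite mcoeffD lowm addr0 me ltnn => /(_ gm).
have hd : mdegree (g + low) = e by rewrite /mdegree hs.
by split=> //; rewrite /top_part hd pihomogD low0 addr0 pihomog_dE.
Qed.

(** * Extension of scalars and the theorem *)

Lemma map_mderiv (k K : fieldType) (phi : {rmorphism k -> K}) n (p : {mpoly k[n]}) i :
  map_mpoly phi p^`M(i) = (map_mpoly phi p)^`M(i).
Proof.
apply/mpolyP => m; rewrite mcoeff_map_mpoly !mcoeff_mderiv mcoeff_map_mpoly.
by rewrite raddfMn.
Qed.

Lemma map_dirderiv (k K : fieldType) (phi : {rmorphism k -> K}) n v (p : {mpoly k[n]}) :
  map_mpoly phi (dirderiv v p) = \sum_i phi (v i) *: (map_mpoly phi p)^`M(i).
Proof.
rewrite (raddf_sum (map_mpoly phi)); apply: eq_bigr => i _.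
by rewrite -map_mderiv; apply: map_mpolyZ.
Qed.

Lemma msize_sub_top (k : fieldType) n (P : {mpoly k[n]}) :
  (msize (P - top_part P) <= mdegree P)%N.
Proof.
rewrite {1}(@pihomog_partitionE _ _ mdeg (mdegree P).+1 P); last exact: leqSpred.
rewrite big_ord_recr /= addrK; apply: msize_le_sum => j _.
by apply: leq_trans (msize_homog (pihomogP _ _ _)) _.
Qed.

Lemma Delta_top (k : fieldType) (V : vectType k) (P : polyOn V) (t : V) e :
  mdegree P = e.+1 -> dirderiv (vcoord t) (top_part P) != 0 ->
  mdegree (Delta t P) = e /\ top_part (Delta t P) = dirderiv (vcoord t) (top_part P).
Proof.
move=> hP g0; pose low := dirderiv (vcoord t) (P - top_part P) +
  (shift (vcoord t) P - P - dirderiv (vcoord t) P).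
have -> : Delta t P = dirderiv (vcoord t) (top_part P) + low.
  by rewrite /low linearB /= /Delta -/(shift (vcoord t) P); ring.
apply: top_partD => //.
  apply: rpred_sum => i _; apply: rpredZ; apply: dhomog_mderiv.
  by rewrite /top_part hP; apply: pihomogP.
have sP : msize P = e.+2 by move: hP; rewrite /mdegree; case: (msize P) => // s /= ->.
apply: leq_trans (msizeD_le _ _) _; rewrite geq_max; apply/andP; split.
  apply: leq_trans (msize_dirderiv _ _) _.
  by have := msize_sub_top P; rewrite hP; case: (msize _).
by apply: leq_trans (shift_sub_dirderiv _ _) _; rewrite sP.
Qed.

Lemma vcoord_surj (k : fieldType) (V : vectType k) (v : 'I_(\dim {:V}) -> k) :
  exists t, vcoord t = v.
Proof.
exists (\sum_i v i *: (vbasis {:V})`_i); apply/funext => i.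
by rewrite /vcoord coord_sum_free // (basis_free (vbasisP _)).
Qed.

(** A nonzero difference of two elements of {0, ..., d} divides d!. *)
Lemma uniq_nat_image (K : fieldType) d : (d`!)%:R != 0 :> K ->
  uniq [seq (i%:R : K) | i <- seq.iota 0 d.+1].
Proof.
move=> nz; have inj i j : (i < j)%N -> (j <= d)%N -> (i%:R : K) != j%:R.
  move=> lt le; rewrite eq_sym -subr_eq0 -natrB 1?ltnW //.
  have : (j - i %| d`!)%N by rewrite dvdn_fact // subn_gt0 lt (leq_trans (leq_subr _ _)).
  by case/dvdnP => q eq; apply: contra_neq nz => h; rewrite eq natrM h mulr0.
rewrite map_inj_in_uniq ?iota_uniq // => i j; rewrite !mem_iota !add0n !ltnS => hi hj.
by case: (ltngtP i j) => // lt /eqP; [| rewrite eq_sym]; rewrite (negPf (inj _ _ lt _)).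
Qed.

(* An algebraic closure of k is an algebraically closed field K together with
   an embedding iota : k -> K over which every element of K is algebraic. *)
Theorem theorem1p2 :
  exists C : nat -> nat -> nat,
  forall (r d : nat), (0 < r)%N -> (3 <= d)%N ->
  forall (k : fieldType), (d`!)%:R != 0 :> k ->
  forall (K : closedFieldType) (iota : {rmorphism k -> K}),
    integralRange iota ->
  forall (V : vectType k) (P : polyOn V),
    mdegree P = d ->
    (forall t : V, (rank iota (Delta t P) <= r)%N) ->
    (rank iota P <= C r d)%N.
Proof.
exists (fun r d => rank_bound r d.-2) => r [|[|D]] // r0 D0 k nz K iota _ V P hP hr.
have {}nz : ((D.+2)`!)%:R != 0 :> K.
  by rewrite -(rmorph_nat iota) fmorph_eq0.
have hf : map_mpoly iota (top_part P) \is D.+2.-homog.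
  apply/dhomogP => m; rewrite mcoeff_msupp mcoeff_map_mpoly fmorph_eq0 -mcoeff_msupp.
  by apply: dhomog_mf; rewrite -hP; apply: pihomogP.
have [r' ler' hdec] : small_rank (map_mpoly iota (top_part P)) (rank_bound r D).
  apply: (rank_from_derivatives (S := [seq i%:R | i <- seq.iota 0 D.+3])) => //.
  - apply: contra_neq nz => h.
    by rewrite factS factS mulnA natrM h mul0r.
  - exact: uniq_nat_image.
  - by rewrite size_map size_iota.
  move=> a /(_ _)/mapP aS.
  have /choice[c hc] i : exists c : nat, a i = c%:R by have [j _ ->] := aS i; exists j.
  have [t ht] := vcoord_surj (fun i => (c i)%:R : k).
  have -> : \sum_i a i *: (map_mpoly iota (top_part P))^`M(i) =
      map_mpoly iota (dirderiv (vcoord t) (top_part P)).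
    by rewrite map_dirderiv; apply: eq_bigr => i _; rewrite ht rmorph_nat hc.
  have [->|g0] := eqVneq (dirderiv (vcoord t) (top_part P)) 0.
    exists 0%N => //; exists (fun=> 0), (fun=> 0).
    by split=> [[]//|]; rewrite raddf0 big_ord0.
  have [hd ht'] := Delta_top hP g0.
  exists (rank iota (Delta t P)); first exact: hr.
  have [|hdec _] := @rank_spec _ _ _ iota (Delta t P); first by rewrite hd.
  by have [L [R h]] := hdec; exists L, R; rewrite -ht'.
have [_ hmin] := rank_spec iota (ltac:(by rewrite hP) : (1 < mdegree P)%N).
by apply: leq_trans ler'; apply: hmin.
Qed.
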